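(* Let $k$ be a field of characteristic zero, let $A=k[\![x_1,\ldots,x_n]\!]$ be the formal power series ring, let $\mathcal D$ be its ring of differential operators, let $E$ be an injective hull of $k$ over $A$ (with its $\mathcal D$-module structure), and let $M$ be a holonomic $\mathcal D$-module. If $m=\dim_k H^n_{DR}(M)$, then there is a surjective homomorphism of $\mathcal D$-modules $$M\longrightarrow E^m\longrightarrow 0.$$
   Context: $\mathcal D=A\langle\partial_1,\ldots,\partial_n\rangle$ is the ring of differential operators over $A$, where $\partial_i=\partial/\partial x_i$; a $\mathcal D$-module is a left $\mathcal D$-module. A finitely generated $\mathcal D$-module has a dimension between $n$ and $2n$; it is holonomic if this dimension is the minimal value $n$ (or the module is zero). For a $\mathcal D$-module $M$, the de Rham complex is $M\otimes_A\Omega^\bullet$, where $\Omega^1$ is the free $A$-module on $dx_1,\ldots,dx_n$ and $\Omega^i$ is its $i$-th exterior power, with differential induced by the actions of $\partial_1,\ldots,\partial_n$ on $M$. Its cohomology is denoted $H^i_{DR}(M)$; in particular $H^n_{DR}(M)=M/(\partial_1M+\cdots+\partial_nM)$. For holonomic $M$ all $H^i_{DR}(M)$ are finite-dimensional over $k$. The injective hull $E$ is realized as the local cohomology module $H^n_{\mathfrak m}(A)$, $\mathfrak m=(x_1,\ldots,x_n)$, with its natural $\mathcal D$-module structure: it has $k$-basis the monomials $x_1^{-a_1}\cdots x_n^{-a_n}$ with all $a_i\ge 1$, on which the $\partial_i$ act by formal differentiation and $x_i$ by multiplication (a monomial in which some exponent becomes $\ge 0$ is zero). *)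

(* Defs.v *)
From HB Require Import structures.
From mathcomp Require Import all_boot all_order all_algebra.
From mathcomp Require Import boolp mpoly.

Set Implicit Arguments.
Unset Strict Implicit.
Unset Printing Implicit Defensive.
Import GRing.Theory.
Local Open Scope ring_scope.

Record fps (k : fieldType) (n : nat) := Fps { fcoef :> 'X_{1..n} -> k }.

HB.instance Definition _ k n := gen_eqMixin (fps k n).
HB.instance Definition _ k n := gen_choiceMixin (fps k n).

Section PowerSeries.
Variables (k : fieldType) (n : nat).
Implicit Types (a b c : fps k n) (m : 'X_{1..n}) (p : {mpoly k[n]}).

Lemma fpsP a b : (forall m, a m = b m) <-> a = b.
Proof.
split=> [h|-> //]; case: a b h => [a] [b] /= h.
by congr Fps; apply: funext.
Qed.

Definition fps_const (c : k) : fps k n := Fps (fun m => if m == 0%MM then c else 0).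
Definition fps_add a b : fps k n := Fps (fun m => a m + b m).
Definition fps_opp a : fps k n := Fps (fun m => - a m).
Definition fps_mul a b : fps k n := Fps (fun m =>
  \sum_(d : 'X_{1..n < (mdeg m).+1, (mdeg m).+1} | m == (d.1 + d.2)%MM)
     a d.1 * b d.2).

Definition fps_partial (i : 'I_n) a : fps k n :=
  Fps (fun m => a (m + U_(i))%MM *+ (m i).+1).

Definition fps_trunc (d : nat) a : {mpoly k[n]} :=
  \sum_(m : 'X_{1..n < d}) a m *: 'X_[m].

Lemma fps_truncE d a m : (mdeg m < d)%N -> (fps_trunc d a)@_m = a m.
Proof. by move=> h; rewrite mcoeff_mpoly. Qed.

Lemma fps_mulE d a b m : (mdeg m < d)%N ->
  fps_mul a b m = (fps_trunc d a * fps_trunc d b)@_m.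
Proof.
move=> h; rewrite mcoeffM /=; apply: eq_bigr => i _.
by rewrite !fps_truncE //; apply: leq_ltn_trans h; rewrite -ltnS bmdeg.
Qed.

Lemma fps_addA : associative fps_add.
Proof. by move=> a b c; apply/fpsP => m /=; rewrite addrA. Qed.
Lemma fps_addC : commutative fps_add.
Proof. by move=> a b; apply/fpsP => m /=; rewrite addrC. Qed.
Lemma fps_add0 : left_id (fps_const 0) fps_add.
Proof. by move=> a; apply/fpsP => m /=; rewrite if_same add0r. Qed.
Lemma fps_addN : left_inverse (fps_const 0) fps_opp fps_add.
Proof. by move=> a; apply/fpsP => m /=; rewrite if_same addNr. Qed.

HB.instance Definition _ :=
  GRing.isZmodule.Build (fps k n) fps_addA fps_addC fps_add0 fps_addN.

Lemma fcoefD a b m : (a + b) m = a m + b m. Proof. by []. Qed.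
Lemma fcoef0 m : (0 : fps k n) m = 0. Proof. by rewrite /= if_same. Qed.
Lemma fcoefN a m : (- a) m = - a m. Proof. by []. Qed.

Lemma fps_mulA : associative fps_mul.
Proof.
move=> a b c; apply/fpsP => m; rewrite !(@fps_mulE (mdeg m).+1) //.
pose t := fps_trunc (mdeg m).+1.
have E x y e : (mdeg e < (mdeg m).+1)%N -> (t (fps_mul x y))@_e = (t x * t y)@_e.
  by move=> h; rewrite fps_truncE // (fps_mulE _ _ h).
transitivity ((t a * (t b * t c))@_m); last rewrite mulrA.
  by rewrite !mcoeffM; apply: eq_bigr => i _; rewrite E ?bmdeg.
by rewrite !mcoeffM; apply: eq_bigr => i _; rewrite E ?bmdeg.
Qed.
Lemma fps_mulC : commutative fps_mul.
Proof.
by move=> a b; apply/fpsP => m; rewrite !(@fps_mulE (mdeg m).+1) // mulrC.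
Qed.
Lemma fps_trunc_const d (c : k) : fps_trunc d.+1 (fps_const c) = c%:MP.
Proof.
apply/mpolyP => m; rewrite mcoeffC.
case: (ltnP (mdeg m) d.+1) => h.
  by rewrite fps_truncE //=; case: eqP; rewrite ?mulr1 ?mulr0.
have -> : (m == 0%MM) = false.
  by apply/eqP => m0; move: h; rewrite m0 mdeg0.
rewrite mulr0n mulr0 /fps_trunc raddf_sum big1 // => i _ /=.
rewrite mcoeffZ mcoeffX; case: (_ =P m) => [e|_]; last by rewrite mulr0.
by have := bmdeg i; rewrite e ltnNge h.
Qed.
Lemma fps_mul1 : left_id (fps_const 1) fps_mul.
Proof.
move=> a; apply/fpsP => m; rewrite (@fps_mulE (mdeg m).+1) //.
by rewrite fps_trunc_const mul1r fps_truncE.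
Qed.
Lemma fps_mulDl : left_distributive fps_mul fps_add.
Proof.
move=> a b c; apply/fpsP => m /=; rewrite -big_split /=.
by apply: eq_bigr => i _; rewrite mulrDl.
Qed.
Lemma fps_const10 : fps_const 1 != 0 :> fps k n.
Proof.
apply/eqP => /(congr1 (fun a : fps k n => a 0%MM)) /=.
by rewrite eqxx; apply/eqP; rewrite oner_neq0.
Qed.

HB.instance Definition _ := GRing.Zmodule_isComNzRing.Build (fps k n)
  fps_mulA fps_mulC fps_mul1 fps_mulDl fps_const10.

Lemma fcoefM d a b m : (mdeg m < d)%N ->
  (a * b) m = (fps_trunc d a * fps_trunc d b)@_m.
Proof. exact: fps_mulE. Qed.

Lemma fps_trunc_partial d i a :
  fps_trunc d (fps_partial i a) = (fps_trunc d.+1 a)^`M(i).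
Proof.
apply/mpolyP => m; rewrite mcoeff_deriv.
case: (ltnP (mdeg m) d) => h.
  by rewrite !fps_truncE //= mdegD mdeg1 addn1.
rewrite /fps_trunc !raddf_sum /= !big1 ?mul0rn // => j _;
  rewrite mcoeffZ mcoeffX; case: eqP => e; rewrite ?mulr0 //.
- by have := bmdeg j; rewrite e mdegD mdeg1 addn1 ltnS ltnNge h.
- by have := bmdeg j; rewrite e ltnNge h.
Qed.

Lemma fps_partialD i : {morph fps_partial i : a b / a + b}.
Proof. by move=> a b; apply/fpsP => m /=; rewrite mulrnDl. Qed.

Lemma fcoef_partial i a m : fps_partial i a m = a (m + U_(i))%MM *+ (m i).+1.
Proof. by []. Qed.

Lemma fps_partialM i a b :
  fps_partial i (a * b) = fps_partial i a * b + a * fps_partial i b.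
Proof.
apply/fpsP => m; rewrite fcoefD fcoef_partial.
have h : (mdeg (m + U_(i))%MM < (mdeg m).+2)%N by rewrite mdegD mdeg1 addn1.
rewrite (fcoefM _ _ h) -mcoeff_deriv mderivM mcoeffD.
rewrite !(@fcoefM (mdeg m).+1) // !fps_trunc_partial !mcoeffM.
have E x (j : 'X_{1..n < (mdeg m).+1}) :
    (fps_trunc (mdeg m).+2 x)@_j = (fps_trunc (mdeg m).+1 x)@_j.
  by rewrite !fps_truncE ?bmdeg // ltnW // ltnS bmdeg.
by congr (_ + _); apply: eq_bigr => j _; rewrite E.
Qed.

Lemma fps_constM (x y : k) : fps_const (x * y) = fps_const x * fps_const y.
Proof.
apply/fpsP => m; rewrite (@fcoefM (mdeg m).+1) // !fps_trunc_const -mpolyCM.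
by rewrite -(fps_trunc_const (mdeg m)) fps_truncE.
Qed.

End PowerSeries.

(** The subring of [End_k(A)] generated by multiplications and partials. *)
Inductive is_diffop (k : fieldType) (n : nat) :
    (fps k n -> fps k n) -> Prop :=
| is_diffop_mul a : is_diffop (fun f => a * f)
| is_diffop_partial i : is_diffop (@fps_partial k n i)
| is_diffop_add P Q : is_diffop P -> is_diffop Q -> is_diffop (fun f => P f + Q f)
| is_diffop_comp P Q : is_diffop P -> is_diffop Q -> is_diffop (fun f => P (Q f)).

Record diffop (k : fieldType) (n : nat) := Diffop {
  diffop_fun :> fps k n -> fps k n;
  diffopP : is_diffop diffop_fun }.

HB.instance Definition _ k n := gen_eqMixin (diffop k n).
HB.instance Definition _ k n := gen_choiceMixin (diffop k n).

Section DiffOp.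
Variables (k : fieldType) (n : nat).
Local Notation A := (fps k n).
Implicit Types (P Q : diffop k n) (f g : A).

Lemma diffop_eqP P Q : (forall f, P f = Q f) <-> P = Q.
Proof.
split=> [h|-> //]; case: P Q h => [P hP] [Q hQ] /= h.
have e : P = Q by apply: funext.
by move: hP; rewrite e => hP; congr Diffop; apply: Prop_irrelevance.
Qed.

Lemma is_diffopD (P : A -> A) : is_diffop P -> {morph P : f g / f + g}.
Proof.
elim=> [a|i|P1 P2 _ h1 _ h2|P1 P2 _ h1 _ h2] f g.
- exact: mulrDr.
- exact: fps_partialD.
- by rewrite h1 h2 addrACA.
- by rewrite h2 h1.
Qed.

Definition dop_mul (a : A) : diffop k n := Diffop (is_diffop_mul a).
Definition dop_partial (i : 'I_n) : diffop k n := Diffop (is_diffop_partial k i).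
Definition dop_add P Q := Diffop (is_diffop_add (diffopP P) (diffopP Q)).
Definition dop_comp P Q := Diffop (is_diffop_comp (diffopP P) (diffopP Q)).
Definition dop_opp P := dop_comp (dop_mul (-1)) P.

Lemma dop_addA : associative dop_add.
Proof. by move=> P Q R; apply/diffop_eqP => f /=; rewrite addrA. Qed.
Lemma dop_addC : commutative dop_add.
Proof. by move=> P Q; apply/diffop_eqP => f /=; rewrite addrC. Qed.
Lemma dop_add0 : left_id (dop_mul 0) dop_add.
Proof. by move=> P; apply/diffop_eqP => f /=; rewrite mul0r add0r. Qed.
Lemma dop_addN : left_inverse (dop_mul 0) dop_opp dop_add.
Proof. by move=> P; apply/diffop_eqP => f /=; rewrite mulN1r mul0r addNr. Qed.

HB.instance Definition _ :=
  GRing.isZmodule.Build (diffop k n) dop_addA dop_addC dop_add0 dop_addN.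

Lemma dop_compA : associative dop_comp.
Proof. by move=> P Q R; apply/diffop_eqP. Qed.
Lemma dop_comp1l : left_id (dop_mul 1) dop_comp.
Proof. by move=> P; apply/diffop_eqP => f /=; rewrite mul1r. Qed.
Lemma dop_comp1r : right_id (dop_mul 1) dop_comp.
Proof. by move=> P; apply/diffop_eqP => f /=; rewrite mul1r. Qed.
Lemma dop_compDl : left_distributive dop_comp dop_add.
Proof. by move=> P Q R; apply/diffop_eqP. Qed.
Lemma dop_compDr : right_distributive dop_comp dop_add.
Proof. by move=> P Q R; apply/diffop_eqP => f /=; rewrite (is_diffopD (diffopP P)). Qed.
Lemma dop_mul10 : dop_mul 1 != dop_mul 0.
Proof.
apply/eqP => /diffop_eqP /(_ 1) /=; rewrite !mulr1; apply/eqP.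
exact: oner_neq0.
Qed.

HB.instance Definition _ := GRing.Zmodule_isNzRing.Build (diffop k n)
  dop_compA dop_comp1l dop_comp1r dop_compDl dop_compDr dop_mul10.

Definition dop_const (c : k) : diffop k n := dop_mul (fps_const n c).

Definition dop_partials (alpha : 'X_{1..n}) : diffop k n :=
  \prod_(i < n) dop_partial i ^+ alpha i.

(** The operator [\sum_alpha p_alpha partial^alpha], for [p] a polynomial in
    [n] commuting symbols with coefficients in [A]. *)
Definition dop_of_symbol (p : {mpoly A[n]}) : diffop k n :=
  \sum_(alpha <- msupp p) dop_mul p@_alpha * dop_partials alpha.

(** Differential operators of order [< j]; only [0] if [j = 0]. *)
Definition dop_order_lt (j : nat) P : Prop :=
  exists2 p : {mpoly A[n]}, (msize p <= j)%N & P = dop_of_symbol p.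

End DiffOp.

(** Inverse polynomials: ['X_[b]] stands for [x_1^(-b_1-1) ... x_n^(-b_n-1)], so
    [x^m * 'X_[b]] is ['X_[b - m]] if [m <= b], and [0] otherwise (see
    [inv_scale_X] and [inv_scale_partialX] below). *)
Section InversePoly.
Variables (k : fieldType) (n : nat).
Local Notation A := (fps k n).
Local Notation E0 := {mpoly k[n]}.
Implicit Types (a b f : A) (e : E0) (c m al be : 'X_{1..n}).

Definition inv_mul a e : E0 :=
  \sum_(c : 'X_{1..n < msize e})
    (\sum_(m : 'X_{1..n < msize e}) a m * e@_(c + m)) *: 'X_[c].

Definition inv_partial (i : 'I_n) e : E0 :=
  \sum_(b <- msupp e) (- (b i).+1%:R * e@_b) *: 'X_[b + U_(i)].

Definition inv_L (d : nat) c e (p : E0) : k :=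
  \sum_(m : 'X_{1..n < d}) p@_m * e@_(c + m).

Lemma inv_L_linear d c e : linear (inv_L d c e : E0 -> k^o).
Proof.
move=> x p q; rewrite /inv_L scaler_sumr -big_split /=; apply: eq_bigr => m _.
by rewrite mcoeffD mcoeffZ mulrDl -mulrA.
Qed.
HB.instance Definition _ d c e := GRing.isLinear.Build k E0 k^o _
  (inv_L d c e : E0 -> k^o) (inv_L_linear d c e).

Lemma inv_coef0 e c m : (msize e <= mdeg m)%N -> e@_(c + m) = 0.
Proof.
move=> h; apply: memN_msupp_eq0; apply/negP => /msize_mdeg_lt.
by rewrite mdegD ltnNge (leq_trans h) // leq_addl.
Qed.

Lemma inv_LX d c e m : (msize e <= d)%N -> inv_L d c e 'X_[m] = e@_(c + m).
Proof.
move=> h; rewrite /inv_L; case: (ltnP (mdeg m) d) => hm.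
  rewrite (bigD1 (BMultinom hm)) //= mcoeffX eqxx mul1r big1 ?addr0 // => j.
  by rewrite -val_eqE /= mcoeffX eq_sym => /negbTE ->; rewrite mul0r.
rewrite inv_coef0 ?(leq_trans h) // big1 // => j _.
rewrite mcoeffX; case: (m =P _) => [e1|]; last by rewrite mul0r.
by have := bmdeg j; rewrite -e1 ltnNge hm.
Qed.

Lemma inv_L_trunc d d' c e a : (d <= d')%N ->
  inv_L d c e (fps_trunc d' a) = \sum_(m : 'X_{1..n < d}) a m * e@_(c + m).
Proof.
move=> h; apply: eq_bigr => m _; rewrite fps_truncE //.
exact: leq_trans (bmdeg m) h.
Qed.

Lemma inv_sum_indep d d' c e a : (msize e <= d)%N -> (d <= d')%N ->
  \sum_(m : 'X_{1..n < d}) a m * e@_(c + m)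
  = \sum_(m : 'X_{1..n < d'}) a m * e@_(c + m).
Proof.
move=> h h'; rewrite -(inv_L_trunc _ _ _ h') /fps_trunc.
rewrite (linear_sum (inv_L d c e : E0 -> k^o)) /=; apply: eq_bigr => m _.
by rewrite linearZ /= inv_LX.
Qed.

Lemma inv_mulE d c a e : (msize e <= d)%N ->
  (inv_mul a e)@_c = \sum_(m : 'X_{1..n < d}) a m * e@_(c + m).
Proof.
move=> h; rewrite -(inv_sum_indep _ _ (leqnn _) h) /inv_mul.
case: (ltnP (mdeg c) (msize e)) => hc.
  exact: (mcoeff_mpoly
    (fun c' => \sum_(m : 'X_{1..n < msize e}) a m * e@_(c' + m)) hc).
rewrite [RHS]big1 => [|j _]; last by rewrite addmC inv_coef0 // mulr0.
rewrite raddf_sum /= big1 // => j _.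
rewrite mcoeffZ mcoeffX; case: (_ =P c) => [e1|]; last by rewrite mulr0.
by have := bmdeg j; rewrite e1 ltnNge hc.
Qed.

Lemma inv_mulL d d' c a e : (msize e <= d)%N -> (d <= d')%N ->
  (inv_mul a e)@_c = inv_L d c e (fps_trunc d' a).
Proof. by move=> h h'; rewrite inv_L_trunc // (inv_mulE _ _ h). Qed.

Lemma inv_mulD a : {morph inv_mul a : e e' / e + e'}.
Proof.
move=> e e'; apply/mpolyP => c; rewrite mcoeffD.
pose d := maxn (maxn (msize e) (msize e')) (msize (e + e')).
rewrite !(@inv_mulE d) ?leq_max ?leqnn ?orbT //.
by rewrite -big_split; apply: eq_bigr => j _ /=; rewrite mcoeffD mulrDr.
Qed.

Lemma inv_mulDl a b e : inv_mul (a + b) e = inv_mul a e + inv_mul b e.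
Proof.
apply/mpolyP => c; rewrite mcoeffD !(inv_mulE _ _ (leqnn _)) -big_split /=.
by apply: eq_bigr => j _; rewrite mulrDl.
Qed.

Lemma inv_mul0 e : inv_mul 0 e = 0.
Proof. by apply: (addrI (inv_mul 0 e)); rewrite -inv_mulDl !addr0. Qed.

Lemma fps_trunc_size d a : (msize (fps_trunc d a) <= d)%N.
Proof.
rewrite msizeE; apply/bigmax_leqP_seq => m + _; rewrite mcoeff_msupp.
apply: contraNT; rewrite -ltnNge ltnS => hm.
rewrite /fps_trunc raddf_sum big1 // => j _ /=.
rewrite mcoeffZ mcoeffX; case: (_ =P m) => [e1|]; last by rewrite mulr0.
by have := bmdeg j; rewrite e1 ltnNge hm.
Qed.

Lemma inv_mulA a b e : inv_mul (a * b) e = inv_mul a (inv_mul b e).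
Proof.
apply/mpolyP => c; pose d := maxn (msize e) (msize (inv_mul b e)).
have he : (msize e <= d)%N by rewrite leq_max leqnn.
have hb : (msize (inv_mul b e) <= d)%N by rewrite leq_max leqnn orbT.
rewrite (inv_mulE _ _ hb) (inv_mulE _ _ he).
transitivity (inv_L d c e (fps_trunc d a * fps_trunc d b)).
  by apply: eq_bigr => m _; rewrite (fcoefM _ _ (bmdeg m)).
rewrite (mpolywME (fps_trunc_size d a) (fps_trunc_size d b)).
rewrite (linear_sum (inv_L d c e : E0 -> k^o)) /=.
rewrite -(pair_bigA _ (fun i j : 'X_{1..n < d} =>
  inv_L d c e (((fps_trunc d a)@_i * (fps_trunc d b)@_j) *: 'X_[i + j]))) /=.
apply: eq_bigr => i _; rewrite (inv_mulE _ _ he) mulr_sumr.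
apply: eq_bigr => j _; rewrite linearZ /= inv_LX // !fps_truncE ?bmdeg //.
by rewrite addmA; exact: (esym (mulrA _ _ _)).
Qed.

Lemma inv_mul1 e : inv_mul 1 e = e.
Proof.
apply/mpolyP => c; rewrite (@inv_mulL (msize e) (msize e).+1) //.
by rewrite fps_trunc_const mpolyC1 -mpolyX0 inv_LX ?addm0.
Qed.

Lemma inv_shiftE (g : 'X_{1..n} -> k) al e c :
  (\sum_(b <- msupp e) (g b * e@_b) *: 'X_[b + al])@_c
  = if (al <= c)%MM then g (c - al)%MM * e@_(c - al) else 0.
Proof.
rewrite raddf_sum /=; case: ifP => h.
  have E (b : 'X_{1..n}) : (b + al == c)%MM = (b == c - al)%MM.
    by rewrite -{1}(submK h) eqm_add2r.
  case: (boolP ((c - al)%MM \in msupp e)) => hc.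
    rewrite (bigD1_seq (c - al)%MM) //= mcoeffZ mcoeffX E eqxx mulr1.
    by rewrite big1 ?addr0 // => b /negbTE hb; rewrite mcoeffZ mcoeffX E hb mulr0.
  rewrite (memN_msupp_eq0 hc) mulr0 big_seq big1 // => b hb.
  rewrite mcoeffZ mcoeffX E; case: (b =P _) => [e1|]; last by rewrite mulr0.
  by move: hc; rewrite -e1 hb.
rewrite big1 // => b _; rewrite mcoeffZ mcoeffX; case: (_ =P c) => [e1|].
  by move: h; rewrite -e1 lem_addl.
by rewrite mulr0.
Qed.

Lemma inv_partialE i e c :
  (inv_partial i e)@_c = - (c i)%:R * e@_(c - U_(i)).
Proof.
rewrite inv_shiftE lep1mP; case: (c i =P 0%N) => [->|/eqP ci] /=.
  by rewrite oppr0 mul0r.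
by rewrite mnmBE mnm1E eqxx subn1 prednK // lt0n.
Qed.

Lemma inv_partialD i : {morph inv_partial i : e e' / e + e'}.
Proof.
by move=> e e'; apply/mpolyP => c; rewrite mcoeffD !inv_partialE mcoeffD mulrDr.
Qed.

Lemma inv_partialM i a e :
  inv_partial i (inv_mul a e)
  = inv_mul (fps_partial i a) e + inv_mul a (inv_partial i e).
Proof.
apply/mpolyP => c; pose d := maxn (msize e) (msize (inv_partial i e)).
have he : (msize e <= d)%N by rewrite leq_max leqnn.
have hb : (msize (inv_partial i e) <= d)%N by rewrite leq_max leqnn orbT.
rewrite mcoeffD inv_partialE (inv_mulL _ _ he (leqnSn d)).
rewrite (inv_mulL _ _ hb (leqnSn d)) (inv_mulL _ _ he (leqnn d)).
rewrite fps_trunc_partial; move: (fps_trunc _ _) => p.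
rewrite [p]mpolyE !(linear_sum (mderiv i)).
rewrite !(linear_sum (inv_L d _ _ : E0 -> k^o)) /= mulr_sumr -big_split /=.
apply: eq_bigr => m _; rewrite !linearZ /= mderivX linearZ /= !inv_LX //.
rewrite inv_partialE mnmDE -![_ *: _]/(_ * _).
have -> : (m i)%:R * e@_(c + (m - U_(i))) = (m i)%:R * e@_(c + m - U_(i)).
  case: (m i =P 0%N) => [->|/eqP mi]; first by rewrite !mul0r.
  by rewrite addmBA // lep1mP.
rewrite -mulrDr mulrCA; congr (_ * _); rewrite -mulrDl natrD opprD addrCA subrr addr0.
case: (c i =P 0%N) => [->|/eqP ci]; first by rewrite oppr0 !mul0r.
by rewrite addmC addmBA ?lep1mP // addmC.
Qed.

(** Normal forms, used only to see that the action of [diffop k n] on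
    inverse polynomials is well defined. *)

Definition fps_dpow al f : A := Fps (fun m =>
  f (m + al)%MM *+ \prod_j ((m j + al j) ^_ (al j))%N).

Definition inv_dpow al e : E0 :=
  \sum_(b <- msupp e)
    ((-1) ^+ mdeg al * (\prod_j ((b + al)%MM j ^_ (al j))%N)%:R * e@_b)
      *: 'X_[b + al].

Lemma inv_dpowE al e c : (inv_dpow al e)@_c =
  (-1) ^+ mdeg al * (\prod_j (c j ^_ (al j))%N)%:R * e@_(c - al).
Proof.
rewrite inv_shiftE; case: ifP => h; first by rewrite submK.
suff -> : (\prod_j (c j ^_ (al j)) = 0)%N by rewrite mulr0 mul0r.
move/negbT: h; rewrite negb_forall => /existsP [j hj].
by rewrite (bigD1 j) //= ffact_small ?mul0n // ltnNge.
Qed.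

Lemma inv_dpow0 e : inv_dpow 0 e = e.
Proof.
apply/mpolyP => c; rewrite inv_dpowE mdeg0 big1 ?mul1r ?subm0 // => j _.
by rewrite mnm0E.
Qed.

Lemma inv_dpowS i be e : inv_partial i (inv_dpow be e) = inv_dpow (be + U_(i)) e.
Proof.
apply/mpolyP => c; rewrite inv_partialE !inv_dpowE mdegD mdeg1 addn1 exprS.
have -> : (c - U_(i) - be = c - (be + U_(i)))%MM by rewrite submDA addmC.
rewrite !mulrA; congr (_ * _); rewrite mulN1r !mulNr; congr (- _).
rewrite [_%:R * _]mulrC -mulrA -natrM; congr (_ * _%:R).
rewrite (bigD1 i) //= [RHS](bigD1 i) //= mulnA; congr (_ * _)%N.
  by rewrite mnmBE mnmDE mnm1E eqxx addn1 ffactnS subn1.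
by apply: eq_bigr => j hj; rewrite mnmBE mnmDE mnm1E eq_sym (negbTE hj) addn0 subn0.
Qed.

Lemma fps_dpow0 f : fps_dpow 0 f = f.
Proof.
apply/fpsP => c /=; rewrite big1 ?addm0 // => j _.
by rewrite mnm0E.
Qed.

Lemma fps_dpowS i be f : fps_partial i (fps_dpow be f) = fps_dpow (be + U_(i)) f.
Proof.
apply/fpsP => m /=; rewrite -mulrnA -addmA [(U_(i) + be)%MM]addmC; congr (_ *+ _).
rewrite (bigD1 i) //= [RHS](bigD1 i) //= mulnAC; congr (_ * _)%N.
  by rewrite !mnmDE mnm1E eqxx !addn1 addnS ffactnSr -addSn addnK.
by apply: eq_bigr => j hj; rewrite !mnmDE mnm1E eq_sym (negbTE hj) !addn0.
Qed.

Definition fps_nf (s : seq (A * 'X_{1..n})) f : A :=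
  \sum_(x <- s) x.1 * fps_dpow x.2 f.
Definition inv_nf (s : seq (A * 'X_{1..n})) e : E0 :=
  \sum_(x <- s) inv_mul x.1 (inv_dpow x.2 e).

Inductive diffop_inv : (A -> A) -> (E0 -> E0) -> Prop :=
| diffop_inv_mul a : diffop_inv (fun f => a * f) (inv_mul a)
| diffop_inv_partial i : diffop_inv (@fps_partial k n i) (inv_partial i)
| diffop_inv_add P Q S T : diffop_inv P S -> diffop_inv Q T ->
    diffop_inv (fun f => P f + Q f) (fun e => S e + T e)
| diffop_inv_comp P Q S T : diffop_inv P S -> diffop_inv Q T ->
    diffop_inv (fun f => P (Q f)) (fun e => S (T e)).

Lemma diffop_inv_ex (P : A -> A) : is_diffop P -> exists T, diffop_inv P T.
Proof.
elim=> [a|i|P1 P2 _ [T1 h1] _ [T2 h2]|P1 P2 _ [T1 h1] _ [T2 h2]].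
- by exists (inv_mul a); constructor.
- by exists (inv_partial i); constructor.
- by exists (fun e => T1 e + T2 e); constructor.
- by exists (fun e => T1 (T2 e)); constructor.
Qed.

Lemma diffop_invD P T : diffop_inv P T -> {morph T : e e' / e + e'}.
Proof.
elim=> [a|i|P1 P2 T1 T2 _ h1 _ h2|P1 P2 T1 T2 _ h1 _ h2] e e'.
- exact: inv_mulD.
- exact: inv_partialD.
- by rewrite h1 h2 addrACA.
- by rewrite h2 h1.
Qed.

Lemma fps_partial0 i : fps_partial i (0 : A) = 0.
Proof. by apply/fpsP => m; rewrite fcoef_partial !fcoef0 mul0rn. Qed.

Lemma inv_partial0 i : inv_partial i 0 = 0.
Proof. by rewrite /inv_partial msupp0 big_nil. Qed.

Lemma inv_mulr0 a : inv_mul a 0 = 0.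
Proof. by apply: (addrI (inv_mul a 0)); rewrite -inv_mulD !addr0. Qed.

Lemma diffop_inv_nf P T : diffop_inv P T -> forall s, exists t,
  (forall f, P (fps_nf s f) = fps_nf t f)
  /\ (forall e, T (inv_nf s e) = inv_nf t e).
Proof.
elim=> [a|i|P1 P2 T1 T2 _ h1 _ h2|P1 P2 T1 T2 _ h1 _ h2] s.
- exists [seq (a * x.1, x.2) | x <- s]; split=> [f|e].
    by rewrite /fps_nf mulr_sumr big_map; apply: eq_bigr => x _; rewrite mulrA.
  rewrite /inv_nf big_map (big_morph _ (inv_mulD a) (inv_mulr0 a)).
  by apply: eq_bigr => x _; rewrite inv_mulA.
- exists ([seq (fps_partial i x.1, x.2) | x <- s]
          ++ [seq (x.1, (x.2 + U_(i))%MM) | x <- s]); split=> [f|e].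
    rewrite /fps_nf (big_morph _ (@fps_partialD k n i) (fps_partial0 i)).
    rewrite big_cat !big_map /= -big_split.
    by apply: eq_bigr => x _; rewrite fps_partialM fps_dpowS.
  rewrite /inv_nf (big_morph _ (inv_partialD i) (inv_partial0 i)).
  rewrite big_cat !big_map /= -big_split.
  by apply: eq_bigr => x _; rewrite inv_partialM inv_dpowS.
- have [t1 [p1 q1]] := h1 s; have [t2 [p2 q2]] := h2 s.
  exists (t1 ++ t2); split=> [f|e]; first by rewrite /fps_nf big_cat p1 p2.
  by rewrite /inv_nf big_cat q1 q2.
- have [t2 [p2 q2]] := h2 s; have [t1 [p1 q1]] := h1 t2.
  by exists t1; split=> [f|e]; rewrite ?p2 ?p1 ?q2 ?q1.
Qed.

Lemma big_by_snd (V : zmodType) (s : seq (A * 'X_{1..n})) (F : A * 'X_{1..n} -> V) :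
  \sum_(x <- s) F x
  = \sum_(al <- undup (map snd s)) \sum_(x <- s | x.2 == al) F x.
Proof.
rewrite (exchange_big_dep xpredT) //= big_seq [RHS]big_seq; apply: eq_bigr => x hx.
rewrite -big_filter; have -> : [seq i <- undup (map snd s) | x.2 == i] = [:: x.2].
  rewrite (eq_filter (a2 := pred1 x.2)) => [|y]; last by rewrite /= eq_sym.
  by rewrite filter_pred1_uniq ?undup_uniq // mem_undup map_f.
by rewrite big_seq1.
Qed.

Lemma inv_mul_suml (I : Type) (r : seq I) (p : pred I) (F : I -> A) e :
  inv_mul (\sum_(x <- r | p x) F x) e = \sum_(x <- r | p x) inv_mul (F x) e.
Proof.
by apply: (big_morph (fun a => inv_mul a e)) => [a b|];
  rewrite ?inv_mulDl ?inv_mul0.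
Qed.

Lemma fps_nfE s f : fps_nf s f =
  \sum_(al <- undup (map snd s)) (\sum_(x <- s | x.2 == al) x.1) * fps_dpow al f.
Proof.
rewrite /fps_nf big_by_snd; apply: eq_bigr => al _.
by rewrite mulr_suml; apply: eq_bigr => x /eqP ->.
Qed.

Lemma inv_nfE s e : inv_nf s e =
  \sum_(al <- undup (map snd s))
     inv_mul (\sum_(x <- s | x.2 == al) x.1) (inv_dpow al e).
Proof.
rewrite /inv_nf big_by_snd; apply: eq_bigr => al _.
by rewrite inv_mul_suml; apply: eq_bigr => x /eqP ->.
Qed.

Definition fps_X be : A := Fps (fun m => (m == be)%:R).

Lemma fps_dpow_X al be : al != be -> (mdeg be <= mdeg al)%N ->
  fps_dpow al (fps_X be) = 0.
Proof.
move=> hne hle; apply/fpsP => m; rewrite fcoef0 /=.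
case: (_ =P be) => [e1|]; last by rewrite mul0rn.
have := congr1 mdeg e1; rewrite mdegD => e2.
have /eqP : mdeg m = 0%N.
  apply/eqP; rewrite -leqn0 -(leq_add2r (mdeg al)) add0n e2 //.
by rewrite mdeg_eq0 => /eqP m0; move: hne; rewrite -e1 m0 add0m eqxx.
Qed.

Lemma fps_dpow_XX be :
  fps_dpow be (fps_X be) = fps_const n (\prod_j (be j)`!)%:R.
Proof.
apply/fpsP => m /=.
have -> : ((m + be)%MM == be) = (m == 0%MM).
  by rewrite -{2}[be]add0m eqm_add2r.
case: (m =P 0%MM) => [->|_]; last by rewrite mul0rn.
by congr (_%:R); apply: eq_bigr => j _; rewrite mnm0E add0n ffactnn.
Qed.

Hypothesis char0 : [pchar k] =i pred0.

Lemma fps_nf_inj s : (forall f, fps_nf s f = 0) ->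
  forall be, \sum_(x <- s | x.2 == be) x.1 = 0.
Proof.
move=> h be; have [d] := ubnP (mdeg be); elim: d be => // d IH be hd.
case: (boolP (be \in map snd s)) => hbe; last first.
  rewrite big_seq_cond big_pred0 // => x; apply/negbTE; apply: contraNN hbe.
  by case/andP => hx /eqP <-; apply: map_f.
have := h (fps_X be); rewrite fps_nfE (bigD1_seq be) ?undup_uniq ?mem_undup //=.
rewrite [X in _ + X]big1 ?addr0 => [|al hal]; last first.
  case: (ltnP (mdeg al) (mdeg be)) => hlt.
    by rewrite IH ?mul0r // (leq_trans hlt).
  by rewrite fps_dpow_X // mulr0.
rewrite fps_dpow_XX => /(congr1 (fun a => a * fps_const n (\prod_j (be j)`!)%:R^-1)).
rewrite -mulrA -fps_constM mul0r divff ?mulr1 //.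
rewrite (pcharf0P _).1 // -lt0n prodn_gt0 // => j.
exact: fact_gt0.
Qed.

Lemma diffop_inv_uniq P T T' : diffop_inv P T -> diffop_inv P T' -> T = T'.
Proof.
move=> h h'; apply: funext => e; apply/eqP; rewrite -subr_eq0; apply/eqP.
have hN : diffop_inv (fun f => P f + (-1) * P f)
                     (fun e => T e + inv_mul (-1) (T' e)).
  by constructor=> //; apply: (diffop_inv_comp (diffop_inv_mul (-1))).
have [t [p q]] := diffop_inv_nf hN [:: (1, 0%MM)].
have e1 x : inv_nf [:: (1, 0%MM)] x = x.
  by rewrite /inv_nf big_seq1 /= inv_mul1 inv_dpow0.
have tz : forall f, fps_nf t f = 0 by move=> f; rewrite -p mulN1r subrr.
have eN x : inv_mul (-1) x = - x.
  by apply: (addIr x); rewrite addNr -{2}[x]inv_mul1 -inv_mulDl addNr inv_mul0.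
have := q e; rewrite e1 eN => ->.
by rewrite inv_nfE big1 // => al _; rewrite fps_nf_inj // inv_mul0.
Qed.

End InversePoly.

Section InverseModule.
Variables (k : fieldType) (char0 : [pchar k] =i pred0) (n : nat).
Local Notation A := (fps k n).

(** Local cohomology [H^n_m(A)], realizing the injective hull of [k].
    Characteristic zero is used to see that the action of [diffop k n] is well
    defined. *)
Definition inv_module of [pchar k] =i pred0 := {mpoly k[n]}.
Local Notation E := (inv_module char0).

HB.instance Definition _ := GRing.Zmodule.on E.

Definition inv_act (P : diffop k n) (e : E) : E :=
  projT1 (cid (diffop_inv_ex (diffopP P))) e.

Lemma inv_actP (P : diffop k n) : diffop_inv P (inv_act P).
Proof. by rewrite /inv_act; case: cid. Qed.

Lemma inv_actE (P : diffop k n) T : diffop_inv P T -> inv_act P = T.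
Proof. exact: (diffop_inv_uniq char0 (inv_actP P)). Qed.

Lemma inv_act_mul a : inv_act (dop_mul a) = inv_mul a.
Proof. by apply: inv_actE; constructor. Qed.
Lemma inv_act_partial i : inv_act (dop_partial k i) = inv_partial i.
Proof. by apply: inv_actE; constructor. Qed.

Lemma inv_actA P Q (e : E) : inv_act P (inv_act Q e) = inv_act (P * Q) e.
Proof.
have -> // : inv_act (P * Q) = fun e => inv_act P (inv_act Q e).
by apply: inv_actE; apply: diffop_inv_comp; apply: inv_actP.
Qed.
Lemma inv_act1 : left_id (1 : diffop k n) inv_act.
Proof. by move=> e; rewrite -[RHS]inv_mul1 -(inv_act_mul 1). Qed.
Lemma inv_actDr : right_distributive inv_act +%R.
Proof. by move=> P e e'; apply: (diffop_invD (inv_actP P)). Qed.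
Lemma inv_actDl (e : E) : {morph inv_act^~ e : P Q / P + Q}.
Proof.
move=> P Q /=.
have -> // : inv_act (P + Q) = fun e => inv_act P e + inv_act Q e.
by apply: inv_actE; apply: diffop_inv_add; apply: inv_actP.
Qed.

HB.instance Definition _ := GRing.Zmodule_isLmodule.Build (diffop k n) E
  inv_actA inv_act1 inv_actDr inv_actDl.

Lemma inv_scale_mul a (e : E) : dop_mul a *: e = inv_mul a e :> E.
Proof. by rewrite -inv_act_mul. Qed.
Lemma inv_scale_partial i (e : E) : dop_partial k i *: e = inv_partial i e :> E.
Proof. by rewrite -inv_act_partial. Qed.

Lemma inv_scale_X (c b : 'X_{1..n}) :
  dop_mul (fps_X k c) *: ('X_[b] : E)
  = (if (c <= b)%MM then 'X_[b - c] else 0) :> {mpoly k[n]}.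
Proof.
rewrite inv_scale_mul; apply/mpolyP => m.
pose d := (maxn (mdeg b) (mdeg c)).+1.
have hc : (mdeg c < d)%N by rewrite ltnS leq_maxr.
rewrite (@inv_mulE _ _ d) ?msizeX ?ltnS ?leq_maxl //.
rewrite (bigD1 (BMultinom hc)) //= eqxx mul1r [X in _ + X]big1 => [|j]; last first.
  by rewrite -val_eqE /= => /negbTE ->; rewrite mul0r.
rewrite addr0 mcoeffX; case: ifP => h.
  by rewrite mcoeffX -{1}(submK h) eqm_add2r.
rewrite mcoeff0; case: eqP => // e1.
by move: h; rewrite e1 lem_addl.
Qed.

Lemma inv_scale_partialX i (b : 'X_{1..n}) :
  dop_partial k i *: ('X_[b] : E)
  = (- (b i).+1%:R) *: 'X_[b + U_(i)] :> {mpoly k[n]}.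
Proof.
by rewrite inv_scale_partial /inv_partial msuppX big_seq1 mcoeffX eqxx mulr1.
Qed.

End InverseModule.

Section KrullDim.
Variable R : comNzRingType.

Definition prime_chain_over (J : {pred R}) (l : nat) (p : nat -> {pred R}) : Prop :=
  (forall i, (i <= l)%N ->
     [/\ idealr_closed (p i), prime_idealr_closed (p i) & {subset J <= p i}])
  /\ (forall i, (i < l)%N ->
     {subset p i <= p i.+1} /\ ~ {subset p i.+1 <= p i}).

(** For an ideal [J]: the Krull dimension of [R / J] is [d]. *)
Definition krull_dim_quot (J : {pred R}) (d : nat) : Prop :=
  (exists p, prime_chain_over J d p)
  /\ (forall l p, prime_chain_over J l p -> (l <= d)%N).
End KrullDim.

Section DModules.
Variables (k : fieldType) (n : nat).
Local Notation D := (diffop k n).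
Local Notation A := (fps k n).
Variable M : lmodType D.

Definition dmod_generates (r : nat) (u : 'I_r -> M) : Prop :=
  forall v, exists P : 'I_r -> D, v = \sum_i P i *: u i.

(** The good filtration [M_j = \sum_i D_(<= j) u_i] defined by generators [u]:
    [good_filtr u j] is [M_(j-1)], with [M_(-1) = 0]. *)
Definition good_filtr (r : nat) (u : 'I_r -> M) (j : nat) (v : M) : Prop :=
  exists2 P : 'I_r -> D, forall i, dop_order_lt j (P i) & v = \sum_i P i *: u i.

(** The annihilator of [gr M] in [gr D = A[zeta_1, ..., zeta_n]]: [p]
    annihilates the graded module [gr M] iff every homogeneous component [p_d]
    does, that is, iff a lift of [p_d] to [D] maps each [M_j] into
    [M_(j+d-1)]. *)
Definition gr_annihilator (r : nat) (u : 'I_r -> M) : {pred {mpoly A[n]}} :=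
  fun p => `[< forall d j v, good_filtr u j.+1 v ->
    good_filtr u (j + d) (dop_of_symbol (pihomog mdeg d p) *: v) >].

(** The dimension is that of [gr M]; it does not depend on the choice of the
    good filtration. *)
Definition dmod_dim (d : nat) : Prop :=
  exists (r : nat) (u : 'I_r -> M),
    dmod_generates u /\ krull_dim_quot (gr_annihilator u) d.

Definition holonomic : Prop := (forall v : M, v = 0) \/ dmod_dim n.

(** [\sum_S w_S dx_S], with [dx_S] the increasing wedge product over [S]. *)
Definition dR_form := {ffun {set 'I_n} -> M}.
HB.instance Definition _ := GRing.Lmodule.on dR_form.

Definition dR_degree (p : nat) (w : dR_form) : Prop :=
  forall S : {set 'I_n}, #|S| != p -> w S = 0.

(** [dx_j /\ dx_(S \ j)] is [dx_S] up to the sign that moves [j] into place. *)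
Definition dR_d (w : dR_form) : dR_form :=
  [ffun S : {set 'I_n} => \sum_(j in S)
     (-1) ^+ #|[set s in S | (s < j)%N]| *: (dop_partial k j *: w (S :\ j))].

Definition dR_cocycle (p : nat) (w : dR_form) : Prop :=
  dR_degree p w /\ dR_d w = 0.

Definition dR_coboundary (p : nat) (w : dR_form) : Prop :=
  if p is q.+1 then exists2 eta, dR_degree q eta & w = dR_d eta else w = 0.

End DModules.

(** For [k]-subspaces [B] and [Z] with [B] contained in [Z]:
    [\dim_k (Z / B) = m]. *)
Definition subquot_dim (k : fieldType) (n : nat) (V : lmodType (diffop k n))
    (Z B : V -> Prop) (m : nat) : Prop :=
  exists e : 'I_m -> V,
    [/\ forall i, Z (e i),
        forall v, Z v -> exists c : 'I_m -> k,
          B (v - \sum_i dop_const n (c i) *: e i)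
      & forall c : 'I_m -> k,
          B (\sum_i dop_const n (c i) *: e i) -> forall i, c i = 0].

(** [\dim_k H^p_DR(M) = m] *)
Definition dR_dim (k : fieldType) (n : nat) (M : lmodType (diffop k n))
    (p m : nat) : Prop :=
  subquot_dim (@dR_cocycle k n M p) (@dR_coboundary k n M p) m.

(** [H^n_DR(M) = M / (partial_1 M + ... + partial_n M)] *)
Section TopDegree.
Variables (k : fieldType) (n : nat) (M : lmodType (diffop k n)).

Let top (v : M) : dR_form M := [ffun S => if S == setT then v else 0].

Lemma card_ord_setT (S : {set 'I_n}) : (#|S| == n) = (S == setT).
Proof.
apply/eqP/eqP => [h|->]; last by rewrite cardsT card_ord.
by apply/eqP; rewrite eqEcard subsetT cardsT card_ord h leqnn.
Qed.

Lemma dR_degree_top (w : dR_form M) : dR_degree n w -> w = top (w setT).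
Proof.
move=> h; apply/ffunP => S; rewrite ffunE.
by case: (S =P setT) => [->//|/eqP hS]; apply: h; rewrite card_ord_setT.
Qed.

Lemma dR_cocycle_top v : dR_cocycle n (top v).
Proof.
split=> [S|]; first by rewrite card_ord_setT ffunE => /negbTE ->.
apply/ffunP => S; rewrite !ffunE big1 // => j hj; rewrite ffunE.
case: eqP => [e|_]; last by rewrite !scaler0.
by have := in_setT j; rewrite -e !inE eqxx.
Qed.

Lemma dR_coboundary_top v :
  dR_coboundary n (top v)
  <-> exists w : 'I_n -> M, v = \sum_i dop_partial k i *: w i.
Proof.
have topT x : top x setT = x by rewrite ffunE eqxx.
pose sg (j : 'I_n) := #|[set s in [set: 'I_n] | (s < j)%N]|.
have sgC j (x : M) : (-1) ^+ sg j *: (dop_partial k j *: x)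
    = dop_partial k j *: ((-1) ^+ sg j *: x).
  by rewrite !scalerA commr_sign.
have main p : p = n -> dR_coboundary p (top v)
    <-> exists w : 'I_n -> M, v = \sum_i dop_partial k i *: w i.
  case: p => [|q] hn.
    have no_ord (i : 'I_n) : False by case: i => i; rewrite -hn.
    split=> [/= h|[w ->]].
      exists (fun=> 0); rewrite big1 => [|i _]; last by case: (no_ord i).
      by have := topT v; rewrite h ffunE.
    by apply/ffunP => S; rewrite !ffunE big1 ?if_same // => i; case: (no_ord i).
  split=> [[eta _ h]|[w hv]].
    exists (fun j => (-1) ^+ sg j *: eta (setT :\ j)).
    rewrite -[v]topT h ffunE; apply: eq_big => [j|j _]; first by rewrite inE.
    by rewrite sgC.
  pose eta : dR_form M :=
    [ffun S => \sum_(j | S == setT :\ j) (-1) ^+ sg j *: w j].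
  have hdeg : dR_degree q eta.
    move=> S hS; rewrite ffunE big_pred0 // => j; apply/negP => /eqP e.
    have := cardsD1 j setT; rewrite in_setT -e cardsT card_ord => h1.
    have h2 : #|S| = q by apply: succn_inj; apply: etrans (esym hn); rewrite [RHS]h1.
    by rewrite h2 eqxx in hS.
  exists eta => //; apply/ffunP => S; rewrite !ffunE.
  case: (S =P setT) => [->|/eqP hS].
    rewrite hv; apply: eq_big => [j|j _]; first by rewrite inE.
    rewrite ffunE (big_pred1 j) => [|i] /=.
      by rewrite sgC scalerA -exprD addnn -signr_odd odd_double expr0 scale1r.
    apply/eqP/eqP => [e|->//]; apply/eqP; rewrite eq_sym; apply/eqP.
    have : j \notin setT :\ i by rewrite -e !inE eqxx.
    by rewrite !inE andbT negbK => /eqP.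
  rewrite big1 // => j hj; rewrite hdeg ?scaler0 //.
  apply: contra hS => /eqP e; rewrite -card_ord_setT (cardsD1 j) hj e.
  by rewrite add1n; apply/eqP.
exact: main.
Qed.

Lemma dR_dim_top m : dR_dim M n m <->
  subquot_dim (fun _ : M => True)
    (fun v => exists w : 'I_n -> M, v = \sum_i dop_partial k i *: w i) m.
Proof.
have topT x : top x setT = x by rewrite ffunE eqxx.
have topD x y : top (x + y) = top x + top y.
  by apply/ffunP => S; rewrite !ffunE; case: eqP; rewrite ?addr0.
have topZ (a : diffop k n) x : top (a *: x) = a *: top x.
  by apply/ffunP => S; rewrite !ffunE; case: eqP; rewrite ?scaler0.
have topN x : top (- x) = - top x by rewrite -scaleN1r topZ scaleN1r.
have top0 : top 0 = 0 by rewrite -(scale0r (0 : M)) topZ scale0r.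
have topS (c : 'I_m -> k) e : top (\sum_i dop_const n (c i) *: e i)
    = \sum_i dop_const n (c i) *: top (e i).
  by rewrite (big_morph top topD top0); apply: eq_bigr => i _; rewrite topZ.
split=> [[e [eZ es ei]]|[e [_ es ei]]].
  have eE i : e i = top (e i setT) by apply: dR_degree_top; case: (eZ i).
  have sE (c : 'I_m -> k) : \sum_i dop_const n (c i) *: e i
      = top (\sum_i dop_const n (c i) *: e i setT).
    by rewrite topS; apply: eq_bigr => i _; rewrite {1}eE.
  exists (fun i => e i setT); split=> // [v _|c hc].
    have [c hc] := es _ (dR_cocycle_top v); exists c.
    by apply/dR_coboundary_top; rewrite topD topN -sE.
  by apply: ei; rewrite sE; apply/dR_coboundary_top.
exists (fun i => top (e i)); split=> [i|w [hw _]|c].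
- exact: dR_cocycle_top.
- have [c hc] := es (w setT) I; exists c.
  rewrite (dR_degree_top hw) -topS -topN -topD.
  exact/dR_coboundary_top.
- by rewrite -topS => /dR_coboundary_top; apply: ei.
Qed.
End TopDegree.

(* Main.v *)
Require Import Defs.
From HB Require Import structures.
From mathcomp Require Import all_boot all_order all_algebra.
From mathcomp Require Import boolp mpoly.

Set Implicit Arguments.
Unset Strict Implicit.
Unset Printing Implicit Defensive.
Import Order.TTheory GRing.Theory.
Local Open Scope ring_scope.

(** Write [A = k[[x_1, ..., x_n]]], [D] for its differential operators and
    [<a, e> = residue (a *: e)] for the residue pairing of [A] with [E], where
    [residue] is the coefficient of [x_1^-1 ... x_n^-1]. Since [E] has a
    countable basis of monomials, this pairing makes [A^I] the full algebraic
    dual of [E^I], for every finite [I]; this is what turns questions on the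
    topology of [A] into plain linear algebra.

    Let [u] be a finite family of generators of [M]. A [D]-linear map from [M]
    to [E] is the same as a solution [h] in [E^I] of all the relations
    [\sum_l P_l u_l = 0]. As [D] is the sum of [A] and of the
    [partial_i D] ([diffop_mod_partials]), every element of [M] is equal to
    some [\sum_l a_l u_l], with [a] in [A^I], up to [\sum_i partial_i M], and
    the residue of its image under the map defined by [h] is [<a, h>]. Let
    [a_1, ..., a_m] represent in this way a basis of [H^n_DR(M)]. If
    [h_1, ..., h_m] are solutions with [<a_i, h_t> = delta_it], the map from [M]
    to [E^m] that they define hits vectors with all possible residues, and such
    a map is onto ([linear_onto]), because a differential operator projects
    elements of [E] of bounded degree to their residue part.

    The solutions [h_t] are found by duality. Let [D_j] be an increasing
    sequence of finitely generated left [A]-submodules with union [D], and let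
    [H_j] be the space of solutions of the relations with entries in [D_j]. As
    [A] is Noetherian, finitely many relations define [H_j]. The transpose of
    a linear map reaches every functional that vanishes on its kernel, so if
    [a] vanishes on [H_j] then [\sum_l a_l u_l] is in [\sum_i partial_i M]
    ([boundary_of_vanishing]). Conversely, when [\sum_l a_l u_l] is in
    [\sum_i partial_i M], some relation of [M] witnesses it, so [a] vanishes on
    some [H_j] ([vanishing_of_boundary]). Hence the [a_i] are linearly
    independent on every [H_j], and each [H_j] contains a family dual to them.
    It remains to find one in the intersection of the [H_j]. Let [W_j] be the
    subspace of [H_j] killed by all [a_i]. Some [W_j] is zero: otherwise there
    is a functional [b] that is nonzero on every [W_j]
    ([functional_nonzero_on_chain], in the spirit of the Baire category
    theorem), but [b] is a combination of the [a_i] up to a functional that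
    vanishes on some [H_j], so it vanishes on [W_j]. From that index on
    the dual family is unique, hence does not depend on [j] ([dual_solutions]).

    That submodules of [A^I] are finitely generated is proved with Dickson's
    lemma. Division by a standard basis only gives an approximation modulo
    each power of the maximal ideal; the passage to the limit is free, because
    the submodule spanned by a finite family equals its double orthogonal for
    the residue pairing ([span_biorthogonal]). *)

(** * Linear algebra *)

(** Recursion in which the step sees the list of all previous values, stated as
    an existence result so that [phi] may come from a choice principle. *)
Lemma course_of_values (T : Type) (phi : seq T -> T) :
  exists f : nat -> T, forall i, f i = phi (mkseq f i).
Proof.
pose g := fix g i := if i is j.+1 then rcons (g j) (phi (g j)) else [::].
exists (fun i => phi (g i)) => i; congr phi.
by elim: i => //= i {1}->; rewrite mkseqS.
Qed.

Lemma triangular_system (k : nzRingType) (h : nat -> nat -> k) (t : nat -> k) :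
  exists a : nat -> k, forall i, \sum_(j < i) a j * h i j + a i = t i.
Proof.
have [a ha] := course_of_values (fun s : seq k =>
  t (size s) - \sum_(j < size s) s`_j * h (size s) j).
exists a => i; rewrite [a i]ha size_mkseq addrCA.
rewrite [X in _ + (X - _)](eq_bigr (fun j : 'I_i => (mkseq a i)`_j * h i j)).
  by rewrite subrr addr0.
by move=> j _; rewrite nth_mkseq.
Qed.

Section CountableDual.
Variables (k : fieldType) (U : lmodType k) (x : nat -> U -> k).
Hypothesis x_lin : forall i, scalar (x i).

(** The functions [x i] are thought of as the coordinates of a vector. *)
Definition supported_below (N : nat) (u : U) := forall i, (N <= i)%N -> x i u = 0.

Definition monic_at (i : nat) (u : U) := x i u = 1 /\ supported_below i.+1 u.

Let x_pack i : {scalar U} :=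
  HB.pack (x i) (GRing.isLinear.Build _ _ _ _ (x i) (x_lin i)).
Let xB i u v : x i (u - v) = x i u - x i v. Proof. exact: (linearB (x_pack i)). Qed.
Let xZ i c u : x i (c *: u) = c * x i u. Proof. exact: (linearZ_LR (x_pack i)). Qed.

Lemma supported_below_cancel N u v : supported_below N.+1 u -> monic_at N v ->
  supported_below N (u - x N u *: v).
Proof.
move=> hu [hv1 hv] i; rewrite leq_eqVlt => /predU1P [<-|hi].
  by rewrite xB xZ hv1 mulr1 subrr.
by rewrite xB xZ (hu i hi) (hv i hi) mulr0 subr0.
Qed.

Lemma monic_at_scale N u : supported_below N.+1 u -> x N u != 0 ->
  monic_at N ((x N u)^-1 *: u).
Proof.
move=> hu h; split=> [|i hi]; first by rewrite xZ mulVf.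
by rewrite xZ (hu i hi) mulr0.
Qed.

(** On the image of [x] in the finitely supported sequences, [lam] is a well
    defined functional. To extend it, pick, for each index [i] where it is
    possible, a vector [h i] with leading term 1 at [i]: the value [a i] is then
    forced by [lam (h i)] and the previous values, and reduction by the [h i]
    shows that these conditions imply all the others. *)
Lemma functional_extension (lam : U -> k) : scalar lam ->
  (forall u, (forall i, x i u = 0) -> lam u = 0) ->
  exists a : nat -> k, forall N u, supported_below N u ->
    lam u = \sum_(i < N) a i * x i u.
Proof.
move=> lam_lin lam_ker.
have /choice [h hP] : forall i, exists v, (exists u, monic_at i u) -> monic_at i v.
  move=> i.
  by case: (pselect (exists u, monic_at i u)) => [[u hu]|hn]; [exists u|exists 0].
have [a ha] := triangular_system (fun i j => x j (h i)) (fun i => lam (h i)).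
exists a; elim=> [|N IH] u hu.
  by rewrite big_ord0 lam_ker // => i; apply: hu.
rewrite big_ord_recr /=; have [h0|hn0] := eqVneq (x N u) 0.
  rewrite h0 mulr0 addr0; apply: IH => i; rewrite leq_eqVlt => /predU1P [<- //|].
  exact: hu.
have hN : monic_at N (h N) by apply: hP; eexists; apply: monic_at_scale hu hn0.
have := IH _ (supported_below_cancel hu hN).
rewrite [u - _]addrC -scaleNr lam_lin => /(canRL (addKr _)) ->.
rewrite -ha mulNr opprK mulrDr [a N * _]mulrC addrAC; congr (_ + _).
rewrite mulr_sumr -big_split; apply: eq_bigr => i _ /=.
by rewrite x_lin mulrCA -mulrDr mulNr addrA subrr add0r.
Qed.

Hypothesis x_fin : forall u, exists N, supported_below N u.
Hypothesis x_inj : forall u, (forall i, x i u = 0) -> u = 0.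

Lemma ex_monic (W : U -> Prop) : (forall c u, W u -> W (c *: u)) ->
  (exists2 u, W u & u <> 0) -> exists i u, W u /\ monic_at i u.
Proof.
move=> WZ [u Wu u0]; have [N hN] := x_fin u.
elim: N hN => [|N IH] hN; first by case: u0; apply: x_inj => i; apply: hN.
have [h0|hn0] := eqVneq (x N u) 0; last first.
  by exists N, ((x N u)^-1 *: u); split; [apply: WZ|apply: monic_at_scale].
apply: IH => i; rewrite leq_eqVlt => /predU1P [<- //|]; exact: hN.
Qed.

(** Let [l j] be the least leading index in [W j]. The vector of [W j] with
    leading term 1 at [l j] is unique, and it is the same for all [j] with the
    same [l j] since the [W j] decrease. So one can prescribe the value 1 at all
    these vectors at once, by recursion on the leading index. *)
Lemma functional_nonzero_on_chain (W : nat -> U -> Prop) :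
  (forall j u v, W j u -> W j v -> W j (u - v)) ->
  (forall j c u, W j u -> W j (c *: u)) ->
  (forall j j' u, (j <= j')%N -> W j' u -> W j u) ->
  (forall j, exists2 u, W j u & u <> 0) ->
  exists a : nat -> k, forall j, exists2 u, W j u &
    forall N, supported_below N u -> \sum_(i < N) a i * x i u <> 0.
Proof.
move=> WB WZ Wdec Wn0.
pose lead j i := `[< exists u, W j u /\ monic_at i u >].
have lead_ex j : exists i, lead j i.
  have [i [u hu]] := ex_monic (WZ j) (Wn0 j).
  by exists i; apply/asboolP; exists u.
pose l j := ex_minn (lead_ex j).
have l_lead j : exists u, W j u /\ monic_at (l j) u.
  by rewrite /l; case: ex_minnP => i /asboolP.
have l_min j u i : W j u -> monic_at i u -> (l j <= i)%N.
  by rewrite /l; case: ex_minnP => p _ h Wu hu; apply: h; apply/asboolP; exists u.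
have l_uniq j u : W j u -> supported_below (l j) u -> u = 0.
  move=> Wu hu; apply: contrapT => u0.
  have WZu c v : (exists d, v = d *: u) -> exists d, c *: v = d *: u.
    by case=> d ->; exists (c * d); rewrite scalerA.
  (* [ex_monic] is applied to the line spanned by [u]: normalizing [u] gives a
     vector of [W j] with leading index below [l j]. *)
  have [|i [v [[d ->] [h1 h2]]]] := ex_monic WZu.
    by exists u => //; exists 1; rewrite scale1r.
  have := l_min j (d *: u) i (WZ _ _ _ Wu) (conj h1 h2).
  move=> /hu h; move: h1; rewrite xZ h mulr0 => /eqP.
  by rewrite eq_sym oner_eq0.
have same j j' u u' : l j = l j' -> W j u -> W j' u' ->
    monic_at (l j) u -> monic_at (l j') u' -> u = u'.
  wlog le_jj' : j j' u u' / (j <= j')%N => [hw|].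
    case/orP: (leq_total j j') => h e Wu Wu' m m'; first exact: hw h e Wu Wu' m m'.
    by apply/esym; apply: hw h (esym e) Wu' Wu m' m.
  move=> e Wu Wu' m m'; apply/eqP; rewrite -subr_eq0; apply/eqP.
  apply: (l_uniq j); first by apply: WB => //; apply: Wdec Wu'.
  have := supported_below_cancel m.2; rewrite m.1 => /(_ u').
  by rewrite e scale1r; apply.
have /choice [h hP] : forall i, exists v, (exists j, l j = i) ->
    exists j, [/\ l j = i, W j v & monic_at i v].
  move=> i.
  case: (pselect (exists j, l j = i)) => [[j <-]|hn]; last by exists 0.
  by have [u [Wu mu]] := l_lead j; exists u => _; exists j.
have [a ha] := triangular_system (fun i j => x j (h i)) (fun _ => 1).
exists a => j; have [u [Wu mu]] := l_lead j; exists u => // N hN.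
have eu : h (l j) = u.
  have [j' [e W' m']] := hP _ (ex_intro _ j erefl).
  by apply: (same j' j) => //; rewrite e.
have hlN : (l j < N)%N.
  rewrite ltnNge; apply/negP => h'; have := hN _ h'; rewrite mu.1 => /eqP.
  by rewrite oner_eq0.
have -> : \sum_(i < N) a i * x i u = 1.
  rewrite -(big_mkord xpredT (fun i => a i * x i u)).
  rewrite (big_cat_nat_idem _ _ hlN) //=; last by rewrite addr0.
  rewrite big_mkord [X in _ + X]big_nat_cond [X in _ + X]big1 ?addr0; last first.
    by move=> i /andP [/andP [hi _] _]; rewrite mu.2 // mulr0.
  by rewrite big_ord_recr /= mu.1 mulr1 -(ha (l j)) eu.
by apply/eqP; rewrite oner_eq0.
Qed.
End CountableDual.

(** A family of rows of [S] of maximal rank spans [S]; a column killed by this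
    family is killed by [S], hence is zero, so the rank is [m]. *)
Lemma separated_subspace_full (k : fieldType) (m : nat) (S : 'rV[k]_m -> Prop) :
  S 0 -> (forall c u v, S u -> S v -> S (c *: u + v)) ->
  (forall c : 'cV[k]_m, (forall v, S v -> v *m c = 0) -> c = 0) ->
  forall v, S v.
Proof.
move=> S0 S_lin S_sep.
have S_span p (B : 'M_(p, m)) : (forall i, S (row i B)) -> forall v, (v <= B)%MS -> S v.
  move=> SB v /submxP [D ->]; rewrite mulmx_sum_row.
  by elim/big_rec: _ => // i w _ Sw; apply: S_lin.
pose rk r := `[< exists p, exists2 B : 'M_(p, m),
  forall i, S (row i B) & \rank B = r >].
have rk_ex : exists r, rk r.
  exists 0%N; apply/asboolP; exists 1%N, 0; last exact: mxrank0.
  by move=> i; rewrite row0.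
have rk_le r : rk r -> (r <= m)%N by move=> /asboolP [p [B _ <-]]; apply: rank_leq_col.
case: (ex_maxnP rk_ex rk_le) => r /asboolP [p [B SB rB]] r_max.
have B_max v : S v -> (v <= B)%MS.
  move=> Sv; have /r_max : rk (\rank (col_mx B v)).
    apply/asboolP; exists (p + 1)%N, (col_mx B v) => // i.
    rewrite -(splitK i); case: (split i) => j /=; first by rewrite rowKu.
    by rewrite rowKd row_id.
  rewrite -rB -addsmxE => hle.
  apply: submx_trans (addsmxSr B v) _.
  by rewrite -(geq_leqif (mxrank_leqif_sup (addsmxSl B v))).
move=> v; apply: (S_span _ B) => //; apply: submx_full.
rewrite -cokermx_eq0; apply/eqP/matrixP => i j.
have := S_sep (col j (cokermx B)); move=> /(_ _)/colP/(_ i); rewrite !mxE; apply.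
move=> w /B_max /submxP [D ->].
by rewrite colE -mulmxA [B *m _]mulmxA mulmx_coker mul0mx mulmx0.
Qed.

(** * Power series as functionals on inverse polynomials *)

Lemma inv_mul_const (k : fieldType) n c (e : {mpoly k[n]}) :
  inv_mul (fps_const n c) e = c *: e.
Proof.
apply/mpolyP => m; rewrite (@inv_mulL _ _ (msize e) (msize e).+1) //.
rewrite fps_trunc_const -[c%:MP]mulr1 mul_mpolyC linearZ /= -mpolyX0 inv_LX //.
by rewrite addm0 mcoeffZ.
Qed.

Lemma fps_constMC (k : fieldType) n c (a : fps k n) m : (fps_const n c * a) m = c * a m.
Proof.
by rewrite (@fcoefM _ _ (mdeg m).+1) // fps_trunc_const mcoeffCM fps_truncE.
Qed.

Section Pairing.
Variables (k : fieldType) (n : nat) (I : finType).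
Local Notation A := (fps k n).
Local Notation E := {mpoly k[n]}.
Implicit Types (a b : I -> A) (e : {ffun I -> E}).

(** The residue of [\sum_l a_l e_l]. *)
Definition pairing a e : k := \sum_l (inv_mul (a l) (e l))@_0%MM.

Lemma pairing_scalar a : scalar (pairing a).
Proof.
move=> c u v; rewrite /pairing mulr_sumr -big_split; apply: eq_bigr => l _ /=.
rewrite !ffunE inv_mulD mcoeffD -[c *: _]inv_mul_const -inv_mulA mulrC inv_mulA.
by rewrite inv_mul_const mcoeffZ.
Qed.

Lemma pairingB a u v : pairing a (u - v) = pairing a u - pairing a v.
Proof. by rewrite addrC -scaleN1r pairing_scalar mulN1r addrC. Qed.

Lemma pairingBl a b e :
  pairing (fun l => a l - b l) e = pairing a e - pairing b e.
Proof.
rewrite /pairing -sumrB; apply: eq_bigr => l _; rewrite inv_mulDl mcoeffD.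
rewrite -mcoeffN; congr (_ + _@__); apply/eqP.
by rewrite -addr_eq0 -inv_mulDl addNr inv_mul0.
Qed.

Lemma pairingE d a e : (forall l, msize (e l) <= d)%N ->
  pairing a e = \sum_l \sum_(m : 'X_{1..n < d}) a l m * (e l)@_m.
Proof.
move=> he; apply: eq_bigr => l _; rewrite (inv_mulE _ _ (he l)).
by apply: eq_bigr => m _; rewrite add0m.
Qed.

Lemma pairing_truncate d a e : (forall l, msize (e l) <= d)%N ->
  (forall l m, (mdeg m < d)%N -> a l m = 0) -> pairing a e = 0.
Proof.
move=> he ha; rewrite (pairingE _ he) big1 // => l _; rewrite big1 // => m _.
by rewrite ha ?bmdeg // mul0r.
Qed.

Lemma ex_msize_bound e : exists d, forall l, (msize (e l) <= d)%N.
Proof. by exists (\max_l msize (e l)) => l; apply: leq_bigmax. Qed.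

(** These vectors separate power series: pairing with them reads off the
    coefficients. *)
Definition monomial_vec (l : I) (m : 'X_{1..n}) : {ffun I -> E} :=
  [ffun l' => if l' == l then 'X_[m] else 0].

Lemma pairing_monomial_vec a l m : pairing a (monomial_vec l m) = a l m.
Proof.
rewrite (@pairingE (mdeg m).+1) => [|l']; last first.
  by rewrite ffunE; case: eqP; rewrite ?msizeX ?msize0.
have hm : (mdeg m < (mdeg m).+1)%N by [].
rewrite (bigD1 l) //= [X in _ + X]big1 ?addr0 => [|l' /negbTE hl]; last first.
  by rewrite big1 // => m' _; rewrite ffunE hl mcoeff0 mulr0.
rewrite (bigD1 (BMultinom hm)) //= ffunE eqxx mcoeffX eqxx mulr1.
rewrite big1 ?addr0 // => m'; rewrite -val_eqE /= => /negbTE hm'.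
by rewrite mcoeffX eq_sym hm' mulr0.
Qed.

Lemma pairing_inj a b : (forall e, pairing a e = pairing b e) -> forall l, a l = b l.
Proof.
by move=> h l; apply/fpsP => m; rewrite -!pairing_monomial_vec.
Qed.

(** The coefficients of [e] listed as one sequence, through the enumeration
    [pickle] of pairs of an index and an exponent; indices that encode no pair
    give the value 0. *)
Definition inv_coord (i : nat) e : k :=
  if pickle_inv i is Some x then (e x.1)@_(x.2 : 'X_{1..n}) else 0.

Lemma inv_coord_scalar i : scalar (inv_coord i).
Proof.
move=> c u v; rewrite /inv_coord; case: pickle_inv => [x|]; last by rewrite mulr0 addr0.
by rewrite !ffunE mcoeffD mcoeffZ.
Qed.

Lemma inv_coord_pickle l m e : inv_coord (pickle (l, m)) e = (e l)@_m.
Proof. by rewrite /inv_coord pickleK_inv. Qed.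

Lemma inv_coord_inj e : (forall i, inv_coord i e = 0) -> e = 0.
Proof.
move=> h; apply/ffunP => l; apply/mpolyP => m.
by rewrite -inv_coord_pickle h ffunE mcoeff0.
Qed.

Lemma inv_coord_neq0 i e : inv_coord i e != 0 ->
  exists x : I * 'X_{1..n}, i = pickle x /\ (e x.1)@_x.2 != 0.
Proof.
rewrite /inv_coord; have := @pickle_invK (I * 'X_{1..n})%type i.
by case: pickle_inv => [x /= <-|_]; [exists x|rewrite eqxx].
Qed.

Lemma inv_coord_fin e : exists N, supported_below inv_coord N e.
Proof.
have [d hd] := ex_msize_bound e.
exists (\max_(x : I * 'X_{1..n < d}) pickle (x.1, val x.2)).+1 => i hi.
apply/eqP; apply: contraTT hi => /inv_coord_neq0 [[l m] [-> /= hm]].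
have hmd : (mdeg m < d)%N.
  apply: leq_trans (hd l); apply: msize_mdeg_lt; by rewrite mcoeff_msupp.
rewrite -ltnNge ltnS.
exact: (leq_bigmax (F := fun x : I * 'X_{1..n < d} => pickle (x.1, val x.2))
  (l, BMultinom hmd)).
Qed.

(** Every sequence of values on monomials is the sequence of coefficients of a
    power series: this identifies [A^I] with the full dual of [E^I]. *)
Lemma inv_coord_pairing (al : nat -> k) N e : supported_below inv_coord N e ->
  \sum_(i < N) al i * inv_coord i e
  = pairing (fun l => Fps (fun m => al (pickle (l, m)))) e.
Proof.
move=> hN; have [d hd] := ex_msize_bound e; rewrite (pairingE _ hd).
rewrite pair_bigA /=.
transitivity (\sum_(x : I * 'X_{1..n < d}) \sum_(i < N | pickle (x.1, val x.2) == i)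
   al i * inv_coord i e); last first.
  apply: eq_bigr => -[l m] _ /=; rewrite -inv_coord_pickle.
  case: (ltnP (pickle (l, val m)) N) => h.
    by rewrite (big_pred1 (Ordinal h)) // => i /=; rewrite eq_sym.
  rewrite (hN _ h) mulr0 big_pred0 // => i; apply/eqP => e1.
  by have := ltn_ord i; rewrite -e1 ltnNge h.
rewrite (exchange_big_dep xpredT) //=; apply: eq_bigr => i _.
have [->|hi] := eqVneq (inv_coord i e) 0.
  by rewrite mulr0 big1 // => *; rewrite mulr0.
have [[l m] [ei hm]] := inv_coord_neq0 hi.
have hmd : (mdeg m < d)%N.
  by apply: leq_trans (hd l); apply: msize_mdeg_lt; rewrite mcoeff_msupp.
rewrite (big_pred1 (l, BMultinom hmd)) // => -[l' m'] /=; rewrite ei.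
by rewrite (inj_eq (pcan_inj pickleK_inv)) -!pair_eqE.
Qed.

(** The transpose of [T], from [A^I] to the dual of [U], reaches all functionals
    that vanish on the kernel of [T]. *)
Lemma pairing_extension (U : lmodType k) (T : U -> {ffun I -> E}) (lam : U -> k) :
  linear T -> scalar lam -> (forall u, T u = 0 -> lam u = 0) ->
  exists b : I -> A, forall u, lam u = pairing b (T u).
Proof.
move=> T_lin lam_lin lam_ker.
have [|u hu|al hal] :=
  @functional_extension k U (fun i u => inv_coord i (T u)) _ lam lam_lin.
- by move=> i c u v; rewrite T_lin inv_coord_scalar.
- exact/lam_ker/inv_coord_inj.
exists (fun l => Fps (fun m => al (pickle (l, m)))) => u.
have [N hN] := inv_coord_fin (T u).
by rewrite -(inv_coord_pairing _ hN) -hal.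
Qed.

Lemma pairing_nonzero_on_chain (W : nat -> {ffun I -> E} -> Prop) :
  (forall j u v, W j u -> W j v -> W j (u - v)) ->
  (forall j c u, W j u -> W j (c *: u)) ->
  (forall j j' u, (j <= j')%N -> W j' u -> W j u) ->
  (forall j, exists2 u, W j u & u <> 0) ->
  exists a : I -> A, forall j, exists2 u, W j u & pairing a u <> 0.
Proof.
move=> WB WZ Wdec Wn0; have [al hal] := functional_nonzero_on_chain inv_coord_scalar
  inv_coord_fin inv_coord_inj WB WZ Wdec Wn0.
exists (fun l => Fps (fun m => al (pickle (l, m)))) => j.
have [u Wu hu] := hal j; exists u => //.
by have [N hN] := inv_coord_fin u; rewrite -(inv_coord_pairing _ hN); apply: hu.
Qed.
End Pairing.

(** * Differential operators modulo derivatives, and duality *)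

Section DiffopAlgebra.
Variables (k : fieldType) (n : nat).
Local Notation A := (fps k n).
Local Notation D := (diffop k n).

Lemma dop_mulM (a b : A) : dop_mul (a * b) = dop_mul a * dop_mul b.
Proof. by apply/diffop_eqP => f /=; rewrite mulrA. Qed.
Lemma dop_mulD (a b : A) : dop_mul (a + b) = dop_mul a + dop_mul b.
Proof. by apply/diffop_eqP => f /=; rewrite mulrDl. Qed.
Lemma dop_mulN (a : A) : dop_mul (- a) = - dop_mul a.
Proof. by apply/diffop_eqP => f /=; rewrite mulN1r mulNr. Qed.
Lemma dop_mul0 : dop_mul (0 : A) = 0. Proof. by []. Qed.
Lemma dop_mul1 : dop_mul (1 : A) = 1. Proof. by []. Qed.

Lemma dop_mul_sum (J : finType) (F : J -> A) :
  dop_mul (\sum_j F j) = \sum_j dop_mul (F j).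
Proof. exact: (big_morph _ dop_mulD dop_mul0). Qed.

Lemma dop_partial_mul i (a : A) :
  dop_partial k i * dop_mul a = dop_mul a * dop_partial k i + dop_mul (fps_partial i a).
Proof. by apply/diffop_eqP => f /=; rewrite fps_partialM addrC. Qed.

Lemma diffop_ind (S : D -> Prop) :
  (forall a, S (dop_mul a)) -> (forall i, S (dop_partial k i)) ->
  (forall P Q, S P -> S Q -> S (P + Q)) -> (forall P Q, S P -> S Q -> S (P * Q)) ->
  forall P, S P.
Proof.
move=> S1 S2 S3 S4 [P hP]; have hP' := hP.
elim: hP' hP => [a|i|P1 P2 h1 IH1 h2 IH2|P1 P2 h1 IH1 h2 IH2] hP.
- by have -> : Diffop hP = dop_mul a by apply/diffop_eqP.
- by have -> : Diffop hP = dop_partial k i by apply/diffop_eqP.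
- have -> : Diffop hP = Diffop h1 + Diffop h2 by apply/diffop_eqP.
  exact: S3.
- have -> : Diffop hP = Diffop h1 * Diffop h2 by apply/diffop_eqP.
  exact: S4.
Qed.

Lemma dop_constC c (P : D) : dop_const n c * P = P * dop_const n c.
Proof.
elim/diffop_ind: P => [a|i|P Q hP hQ|P Q hP hQ].
- by rewrite /dop_const -!dop_mulM mulrC.
- rewrite dop_partial_mul; have -> : fps_partial i (fps_const n c) = 0.
    apply/fpsP => m; rewrite fcoef_partial fcoef0 /=.
    have -> : (m + U_(i) == 0)%MM = false.
      by rewrite -mdeg_eq0 mdegD mdeg1 addn1.
    by rewrite mul0rn.
  by rewrite dop_mul0 addr0.
- by rewrite mulrDl mulrDr hP hQ.
- by rewrite mulrA hP -mulrA hQ mulrA.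
Qed.

(** The operators of this form are stable under multiplication on the right: by
    a function clearly, and by [partial_j] because [c partial_j] is
    [partial_j c] minus the derivative of [c]. Here [c] is the value at 1 of the
    transpose of [P]. *)
Lemma diffop_mod_partials (P : D) :
  exists c Q, P = dop_mul c + \sum_i dop_partial k i * Q i.
Proof.
suff h : forall R, (exists c Q, R = dop_mul c + \sum_i dop_partial k i * Q i) ->
    exists c Q, R * P = dop_mul c + \sum_i dop_partial k i * Q i.
  rewrite -[P]mul1r; apply: h; exists 1, (fun=> 0).
  by rewrite big1 ?addr0 // => i _; rewrite mulr0.
elim/diffop_ind: P => [a|j|P1 P2 h1 h2|P1 P2 h1 h2] R.
- case=> c [Q ->]; exists (c * a), (fun i => Q i * dop_mul a).
  rewrite mulrDl mulr_suml dop_mulM; congr (_ + _).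
  by apply: eq_bigr => i _; rewrite mulrA.
- case=> c [Q ->].
  exists (- fps_partial j c), (fun i => Q i * dop_partial k j + dop_mul c *+ (i == j)).
  have -> : \sum_i dop_partial k i * (Q i * dop_partial k j + dop_mul c *+ (i == j))
      = \sum_i dop_partial k i * Q i * dop_partial k j + dop_partial k j * dop_mul c.
    under eq_bigr do rewrite mulrDr mulrA.
    rewrite big_split /= [X in _ + X](bigD1 j) //= eqxx mulr1n.
    rewrite [X in _ + (_ + X)]big1 ?addr0 // => i /negbTE ->.
    by rewrite mulr0n mulr0.
  rewrite mulrDl mulr_suml dop_partial_mul dop_mulN.
  by rewrite addrC addrCA [dop_mul c * _ + _]addrC addKr.
- move=> hR; rewrite mulrDr.
  have [c [Q ->]] := h1 R hR; have [c' [Q' ->]] := h2 R hR.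
  exists (c + c'), (fun i => Q i + Q' i); rewrite dop_mulD addrACA -big_split /=.
  by congr (_ + _); apply: eq_bigr => i _; rewrite mulrDr.
- by move=> hR; rewrite mulrA; apply: h2; apply: h1.
Qed.

(** [fps_dpow al] is the iterated derivative of multi-exponent [al]. *)
Lemma dop_dpow_ex (al : 'X_{1..n}) : exists Q : D, forall f, Q f = fps_dpow al f.
Proof.
have [d] := ubnP (mdeg al); elim: d al => // d IH al hd.
have [->|] := eqVneq al 0%MM.
  by exists 1 => f; rewrite fps_dpow0 /= mul1r.
rewrite -mdeg_eq0 mdegE sum_nat_eq0 negb_forall => /existsP [i /= hi].
have e : al = (al - U_(i) + U_(i))%MM by rewrite submK // lep1mP.
have [|Q hQ] := IH (al - U_(i))%MM.
  by move: hd; rewrite {1}e mdegD mdeg1 addn1.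
by exists (dop_partial k i * Q) => f; rewrite [in RHS]e -fps_dpowS -hQ.
Qed.

Definition left_span (Q : nat -> D) (j : nat) (P : D) :=
  exists a : nat -> A, P = \sum_(i < j) dop_mul (a i) * Q i.

Lemma left_span0 Q j : left_span Q j 0.
Proof. by exists (fun=> 0); rewrite big1 // => i _; rewrite mul0r. Qed.

Lemma left_spanD Q j P P' :
  left_span Q j P -> left_span Q j P' -> left_span Q j (P + P').
Proof.
move=> [a ->] [b ->]; exists (fun i => a i + b i); rewrite -big_split /=.
by apply: eq_bigr => i _; rewrite dop_mulD mulrDl.
Qed.

Lemma left_span_leq Q j j' P : (j <= j')%N -> left_span Q j P -> left_span Q j' P.
Proof.
move=> hj [a ->]; exists (fun i => if (i < j)%N then a i else 0).
rewrite (big_ord_widen _ (fun i => dop_mul (a i) * Q i) hj) big_mkcond.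
by apply: eq_bigr => i _; case: ifP => _ //=; rewrite mul0r.
Qed.

(** The iterated derivatives span [D] over [A], by the normal form of
    differential operators. *)
Lemma diffop_countably_spanned :
  exists Q : nat -> D, forall P, exists j, left_span Q j P.
Proof.
have /choice [dq hdq] := dop_dpow_ex.
exists (fun i => if unpickle i is Some al then dq al else 0) => P.
have [T hT] := diffop_inv_ex (diffopP P).
have [s [hs _]] := diffop_inv_nf hT [:: (1, 0%MM)].
have -> : P = \sum_(x <- s) dop_mul x.1 * dq x.2.
  apply/diffop_eqP => f; have := hs f.
  rewrite {1}/fps_nf big_seq1 /= fps_dpow0 mul1r => ->.
  rewrite /fps_nf; elim: s {hs} => [|x s IH]; first by rewrite !big_nil /= mul0r.
  by rewrite !big_cons IH /= hdq.
elim: s {hs} => [|x s [j IH]]; first by exists 0%N; rewrite big_nil; apply: left_span0.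
exists (maxn j (pickle x.2).+1); rewrite big_cons; apply: left_spanD; last first.
  by apply: left_span_leq IH; apply: leq_maxl.
apply: (@left_span_leq _ (pickle x.2).+1); first exact: leq_maxr.
exists (fun i => if i == pickle x.2 then x.1 else 0).
rewrite big_ord_recr /= eqxx pickleK big1 ?add0r // => i _.
by rewrite ltn_eqF // mul0r.
Qed.

End DiffopAlgebra.

Section Boundaries.
Variables (k : fieldType) (n : nat).
Local Notation D := (diffop k n).

(** The kernel of [M -> H^n_DR(M)]. *)
Definition boundary (M : lmodType D) (v : M) : Prop :=
  exists w : 'I_n -> M, v = \sum_i dop_partial k i *: w i.

Lemma boundaryD (M : lmodType D) (v w : M) :
  boundary v -> boundary w -> boundary (v + w).
Proof.
move=> [x ->] [y ->]; exists (fun i => x i + y i); rewrite -big_split /=.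
by apply: eq_bigr => i _; rewrite scalerDr.
Qed.

Lemma boundaryZ (M : lmodType D) c (v : M) :
  boundary v -> boundary (dop_const n c *: v).
Proof.
move=> [x ->]; exists (fun i => dop_const n c *: x i); rewrite scaler_sumr.
by apply: eq_bigr => i _; rewrite !scalerA dop_constC.
Qed.

Lemma dop_const_opp1 : dop_const n (-1 : k) = -1.
Proof.
rewrite /dop_const; have -> : fps_const n (-1 : k) = -1.
  by apply/fpsP => m; rewrite fcoefN /=; case: eqP; rewrite ?oppr0.
by rewrite dop_mulN.
Qed.

Lemma boundaryN (M : lmodType D) (v : M) : boundary v -> boundary (- v).
Proof. by move/(boundaryZ (-1)); rewrite dop_const_opp1 scaleN1r. Qed.

Lemma boundary_sum (M : lmodType D) (J : finType) (F : J -> M) :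
  (forall j, boundary (F j)) -> boundary (\sum_j F j).
Proof.
move=> h; elim/big_ind: _ => // [|x y]; last exact: boundaryD.
by exists (fun=> 0); rewrite big1 // => i _; rewrite scaler0.
Qed.

Lemma boundary_scale (M : lmodType D) (Q : 'I_n -> D) (v : M) :
  boundary ((\sum_i dop_partial k i * Q i) *: v).
Proof.
exists (fun i => Q i *: v); rewrite scaler_suml.
by apply: eq_bigr => i _; rewrite scalerA.
Qed.

End Boundaries.

Section Residue.
Variables (k : fieldType) (char0 : [pchar k] =i pred0) (n : nat).
Local Notation A := (fps k n).
Local Notation D := (diffop k n).
Local Notation E := (inv_module n char0).

Definition residue (e : E) : k := (e : {mpoly k[n]})@_0%MM.

Lemma residueD e e' : residue (e + e') = residue e + residue e'.
Proof. exact: mcoeffD. Qed.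

Lemma residue0 : residue 0 = 0. Proof. exact: mcoeff0. Qed.

Lemma residue_sum (J : finType) (F : J -> E) :
  residue (\sum_j F j) = \sum_j residue (F j).
Proof. exact: (big_morph _ residueD residue0). Qed.

Lemma residue_boundary e : boundary e -> residue e = 0.
Proof.
move=> [w ->]; rewrite residue_sum big1 // => i _.
by rewrite /residue inv_scale_partial inv_partialE mnm0E oppr0 mul0r.
Qed.

Lemma dop_const_inv c (e : E) :
  dop_const n c *: e = (c *: (e : {mpoly k[n]})) :> {mpoly k[n]}.
Proof. by rewrite inv_scale_mul inv_mul_const. Qed.

Section Rows.
Variable I : finType.
Implicit Types (P : I -> D) (e : {ffun I -> {mpoly k[n]}}).

(** A row [P] of operators stands for the relation [\sum_l P_l u_l = 0]; [e]
    satisfies it when [apply_row P e = 0]. *)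
Definition apply_row P e : E := \sum_l P l *: (e l : E).

Lemma apply_row_linear P :
  linear (apply_row P : {ffun I -> {mpoly k[n]}} -> {mpoly k[n]}).
Proof.
move=> c u v; rewrite -[c *: apply_row P u](dop_const_inv c (apply_row P u)).
rewrite /apply_row scaler_sumr.
transitivity (\sum_l (dop_const n c *: (P l *: (u l : E)) + P l *: (v l : E)) : E).
  apply: eq_bigr => l _; rewrite !ffunE.
  by rewrite -(dop_const_inv c (u l)) scalerDr !scalerA dop_constC.
by rewrite big_split.
Qed.

(** The terms [partial_i Q] only contribute derivatives, which have residue 0. *)
Lemma residue_apply_row P (c : I -> A) Q e :
  (forall l, P l = dop_mul (c l) + \sum_i dop_partial k i * Q l i) ->
  residue (apply_row P e) = pairing c e.
Proof.
move=> hP; rewrite residue_sum; apply: eq_bigr => l _.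
rewrite hP scalerDl residueD [X in _ + X]residue_boundary; last exact: boundary_scale.
by rewrite addr0 /residue inv_scale_mul.
Qed.

Lemma residue_apply_row_mul (c : I -> A) e :
  residue (apply_row (fun l => dop_mul (c l)) e) = pairing c e.
Proof.
rewrite (@residue_apply_row _ c (fun _ _ => 0)) // => l.
by rewrite big1 ?addr0 // => *; rewrite mulr0.
Qed.

End Rows.

Section Duality.
Variables I J : finType.
Implicit Types (P : J -> I -> D) (a : I -> A) (b : J -> A).
Implicit Types e : {ffun I -> {mpoly k[n]}}.

Lemma pairing_apply_row P b e :
  pairing b [ffun j => apply_row (P j) e : {mpoly k[n]}]
  = residue (apply_row (fun l => \sum_j dop_mul (b j) * P j l) e).
Proof.
rewrite -residue_apply_row_mul; congr residue; rewrite /apply_row.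
under eq_bigr do rewrite ffunE scaler_sumr.
rewrite exchange_big; apply: eq_bigr => l _ /=.
by rewrite scaler_suml; apply: eq_bigr => j _; rewrite scalerA.
Qed.

(** [b] is a system of multipliers: [a] is obtained by applying to [b] the
    transpose of the matrix of operators [P]. *)
Lemma multipliers_of_vanishing P a :
  (forall e, (forall j, apply_row (P j) e = 0) -> pairing a e = 0) ->
  exists b : J -> A, forall e,
    pairing a e = residue (apply_row (fun l => \sum_j dop_mul (b j) * P j l) e).
Proof.
move=> h; have [||u hu|b hb] := @pairing_extension k n J _
    (fun e => [ffun j => apply_row (P j) e : {mpoly k[n]}]) (pairing a).
- move=> c u v; apply/ffunP => j; rewrite !ffunE.
  exact: apply_row_linear.
- exact: pairing_scalar.
- by apply: h => j; have /ffunP/(_ j) := hu; rewrite !ffunE.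
by exists b => e; rewrite hb pairing_apply_row.
Qed.

(** With the multipliers [b] of [multipliers_of_vanishing], the row
    [\sum_j b_j P_j] differs from [a] by a row with entries in the sum of the
    [partial_i D], and it kills [u]. *)
Lemma boundary_of_finite_system P (M : lmodType D) (u : I -> M) a :
  (forall j, \sum_l P j l *: u l = 0) ->
  (forall e, (forall j, apply_row (P j) e = 0) -> pairing a e = 0) ->
  boundary (\sum_l dop_mul (a l) *: u l).
Proof.
move=> hu /multipliers_of_vanishing [b hb].
have /choice [c /choice [Q hQ]] l := diffop_mod_partials (\sum_j dop_mul (b j) * P j l).
have ac : forall l, a l = c l.
  by apply: pairing_inj => e; rewrite hb (residue_apply_row _ hQ).
have -> : \sum_l dop_mul (a l) *: u l
    = - \sum_l (\sum_i dop_partial k i * Q l i) *: u l.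
  apply/eqP; rewrite -addr_eq0 -big_split /=; apply/eqP.
  under eq_bigr do rewrite ac -scalerDl -hQ scaler_suml.
  rewrite exchange_big big1 //= => j _.
  by under eq_bigr do rewrite -scalerA; rewrite -scaler_sumr hu scaler0.
by apply: boundaryN; apply: boundary_sum => l; apply: boundary_scale.
Qed.

(** Solving the system of multiplication operators [g]: an element of the
    double orthogonal of a finite family lies in its [A]-span. In particular
    this span is closed for the topology of [A^I]. *)
Lemma span_biorthogonal (g : J -> I -> A) (a : I -> A) :
  (forall e, (forall b : J -> A, pairing (fun l => \sum_j b j * g j l) e = 0) ->
     pairing a e = 0) ->
  exists b : J -> A, forall l, a l = \sum_j b j * g j l.
Proof.
move=> h; have [|b hb] := @multipliers_of_vanishing (fun j l => dop_mul (g j l)) a.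
  move=> e he; apply: h => b.
  transitivity
    (pairing b [ffun j => apply_row (fun l => dop_mul (g j l)) e : {mpoly k[n]}]).
    rewrite pairing_apply_row -residue_apply_row_mul; congr residue.
    apply: eq_bigr => l _; congr (_ *: _).
    by rewrite dop_mul_sum; apply: eq_bigr => j _; rewrite dop_mulM.
  by rewrite /pairing big1 // => j _; rewrite ffunE he inv_mulr0 mcoeff0.
exists b; apply: pairing_inj => e; rewrite hb -residue_apply_row_mul; congr residue.
apply: eq_bigr => l _; congr (_ *: _).
by rewrite dop_mul_sum; apply: eq_bigr => j _; rewrite dop_mulM.
Qed.
End Duality.
End Residue.

(** * Submodules of [A^I] are finitely generated *)

(** Beyond any [N] the sequence [f] attains its minimum over the indices
    [>= N]; iterate this choice. *)
Lemma nondecreasing_subsequence (f : nat -> nat) : exists2 g : nat -> nat,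
  {homo g : i j / (i < j)%N} & {homo (fun i => f (g i)) : i j / (i <= j)%N}.
Proof.
have /choice [p hp] N : exists p, (N <= p)%N /\ forall q, (p <= q)%N -> (f p <= f q)%N.
  have [v] := ubnP (f N); elim: v N => // v IH N hN.
  case: (pselect (exists2 q, (N <= q)%N & (f q < f N)%N)) => [[q hq hlt]|hn].
    have [p [h1 h2]] := IH q (leq_trans hlt hN).
    by exists p; split=> //; apply: leq_trans h1.
  exists N; split=> // q hq; rewrite leqNgt; apply/negP => h; apply: hn.
  by exists q.
have g_mono : {homo (fun i => iter i (fun q => p q.+1) (p 0)) : i j / (i < j)%N}.
  by apply: homo_ltn => [|i]; [exact: ltn_trans|exact: (hp _).1].
eexists; first exact: g_mono.
move=> i j; rewrite leq_eqVlt => /predU1P [-> //|/g_mono h].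
have [N e] : exists N, iter i (fun q => p q.+1) (p 0) = p N.
  by case: (i) => [|i']; [exists 0%N|eexists; rewrite iterS].
by move: h; rewrite e => /ltnW; apply: (hp N).2.
Qed.

Section Dickson.
Variable n : nat.

Lemma mnm_wqo (f : nat -> 'X_{1..n}) : exists i j, (i < j)%N /\ (f i <= f j)%MM.
Proof.
have [g g_mono hg] : exists2 g : nat -> nat, {homo g : i j / (i < j)%N} &
    forall l, l \in enum 'I_n -> {homo (fun i => f (g i) l) : i j / (i <= j)%N}.
  elim: (enum _) => [|l s [g g_mono hg]]; first by exists id.
  have [h h_mono hh] := nondecreasing_subsequence (fun i => f (g i) l).
  exists (g \o h) => [i j /h_mono /g_mono //|l'].
  rewrite inE => /predU1P [-> //|/hg hl] i j; rewrite leq_eqVlt => /predU1P [-> //|].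
  by move/h_mono/ltnW/hl.
exists (g 0%N), (g 1%N); split; first exact: g_mono.
by apply/mnm_lepP => l; apply: hg; rewrite ?mem_enum.
Qed.

(** Otherwise one could build, element by element, a sequence in [S] none of
    whose terms is above an earlier one. *)
Lemma dickson (S : 'X_{1..n} -> Prop) : exists s : seq 'X_{1..n},
  (forall m, m \in s -> S m) /\
  (forall m, S m -> exists2 m', m' \in s & (m' <= m)%MM).
Proof.
apply: contrapT => hn.
have /choice [phi hphi] (s : seq 'X_{1..n}) : exists m, (forall m', m' \in s -> S m') ->
    S m /\ forall m', m' \in s -> ~~ (m' <= m)%MM.
  case: (pselect (forall m', m' \in s -> S m')) => [hs|]; last by exists 0%MM.
  apply: contrapT => hm; apply: hn; exists s; split=> // m Sm.
  apply: contrapT => hm'; apply: hm; exists m => _; split=> // m' h'.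
  by apply/negP => hle; apply: hm'; exists m'.
have [f hf] := course_of_values phi.
have fS i : forall m', m' \in mkseq f i -> S m'.
  elim: i => // i IH m'; rewrite mkseqS mem_rcons inE => /predU1P [->|/IH //].
  by rewrite hf; exact: (hphi _ IH).1.
have [i [j [hij]]] := mnm_wqo f; apply/negP; rewrite [f j]hf.
by apply: (hphi _ (fS j)).2; apply/mapP; exists i => //; rewrite mem_iota.
Qed.
End Dickson.

Section Noetherian.
Variables (k : fieldType) (char0 : [pchar k] =i pred0) (n : nat).
Local Notation A := (fps k n).
Implicit Types (a b : A) (m : 'X_{1..n}).

Lemma fps_XM be a m :
  (fps_X k be * a) m = if (be <= m)%MM then a (m - be)%MM else 0.
Proof.
have fcoef_mul (f h : A) : (f * h) m =
  \sum_(d : 'X_{1..n < (mdeg m).+1, (mdeg m).+1} | m == (d.1 + d.2)%MM)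
    f d.1 * h d.2 by [].
have [N hN] : exists N, N = (mdeg m).+1 by eexists.
rewrite fcoef_mul -hN /=.
case: ifP => h; last first.
  rewrite big1 // => -[d1 d2] /= /eqP e; case: eqP => [e1|]; last by rewrite mul0r.
  by move: h; rewrite {1}e e1 lem_addr.
have h1 : (mdeg be < N)%N.
  by rewrite hN ltnS -(submK h) mdegD leq_addl.
have h2 : (mdeg (m - be)%MM < N)%N.
  by rewrite hN ltnS -{2}(submK h) mdegD leq_addr.
rewrite (bigD1 (BMultinom h1, BMultinom h2)) /=; last by rewrite addmC submK.
rewrite eqxx mul1r big1 ?addr0 // => -[d1 d2] /= /andP [/eqP e hne].
case: eqP => [e1|]; last by rewrite mul0r.
case/eqP: hne; congr (_, _); apply: val_inj => //=.
by rewrite e e1 addmC addmK.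
Qed.

(** The order [%O] on exponents is the degree-lexicographic one: it is
    compatible with addition and has finitely many elements in each degree. *)
Definition initial_exponent a m := a m <> 0 /\ forall m', (m' < m)%O -> a m' = 0.

Lemma ex_initial a m : a m <> 0 -> exists2 m0, initial_exponent a m0 & (m0 <= m)%O.
Proof.
elim/(well_founded_ind (@ltom_wf n)): m => m IH hm.
case: (pselect (exists2 m', (m' < m)%O & a m' <> 0)) => [[m' hlt hm']|hn].
  have [m0 h0 hle] := IH _ hlt hm'.
  by exists m0 => //; apply: ltW (le_lt_trans hle hlt).
exists m => //; split=> // m' hlt; apply: contrapT => h; apply: hn.
by exists m'.
Qed.

Section Ideal.
Variable J : A -> Prop.
Hypothesis J_lin : forall x a b, J a -> J b -> J (x * a + b).

Lemma ex_standard_basis : exists (s : nat) (g : 'I_s -> A), (forall j, J (g j)) /\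
  forall a m, J a -> initial_exponent a m ->
    exists j m', initial_exponent (g j) m' /\ (m' <= m)%MM.
Proof.
have [s [sS hs]] := dickson (fun m => exists2 a, J a & initial_exponent a m).
have /choice [G hG] m : exists a, (exists2 a, J a & initial_exponent a m) ->
    J a /\ initial_exponent a m.
  case: (pselect (exists2 a, J a & initial_exponent a m)) => [[a h1 h2]|hn].
    by exists a.
  by exists 0.
have hGs (j : 'I_(size s)) :
    J (G (nth 0%MM s j)) /\ initial_exponent (G (nth 0%MM s j)) (nth 0%MM s j).
  by apply: hG; apply: sS; apply: mem_nth.
exists (size s), (fun j => G (nth 0%MM s j)).
split=> [j|a m Ja am]; first exact: (hGs j).1.
have [|m' hm' hle] := hs m; first by exists a.
have hj : (index m' s < size s)%N by rewrite index_mem.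
exists (Ordinal hj), m'; split=> //.
by have := (hGs (Ordinal hj)).2; rewrite /= nth_index.
Qed.

Lemma reduce_initial a b m m' : initial_exponent a m -> initial_exponent b m' ->
  (m' <= m)%MM -> exists x, forall m0, (m0 <= m)%O -> (x * b + a) m0 = 0.
Proof.
move=> [am ha] [bm hb] hle.
exists (fps_const n (- (a m / b m')) * fps_X k (m - m')) => m0 hm0.
rewrite fcoefD -mulrA fps_constMC fps_XM.
have [->|hne] := eqVneq m0 m.
  have -> : (m - m' <= m)%MM by rewrite -{2}(submK hle) lem_addr.
  have -> : (m - (m - m') = m')%MM by rewrite -{1}(submK hle) addmC addmK.
  by rewrite mulNr divfK ?addNr //; apply/eqP.
have hlt : (m0 < m)%O by rewrite lt_neqAle hne.
rewrite (ha _ hlt) addr0; case: ifP => h; last by rewrite mulr0.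
rewrite (hb (m0 - (m - m'))%MM) ?mulr0 //.
have <- := ltmc_add2r (m - m') (m0 - (m - m')) m'.
by rewrite [X in (X < _)%O]addmC [X in (_ < X)%O]addmC (submK h) addmC (submK hle).
Qed.

(** Division by the standard basis [g]. Each step raises the initial exponent
    of [a], and there are finitely many exponents of degree less than [d]. *)
Lemma ideal_dense (s : nat) (g : 'I_s -> A) : (forall j, J (g j)) ->
  (forall a m, J a -> initial_exponent a m ->
    exists j m', initial_exponent (g j) m' /\ (m' <= m)%MM) ->
  forall d a, J a -> exists b : 'I_s -> A,
    forall m, (mdeg m < d)%N -> (a - \sum_j b j * g j) m = 0.
Proof.
(* The number of exponents of degree less than [d] that are not below the
   initial exponent of [a]. *)
move=> Jg hg d a; pose phi a := #|[pred m : 'X_{1..n < d} |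
  `[< exists2 m', (m' <= (m : 'X_{1..n}))%O & a m' <> 0 >]]|.
have [N] := ubnP (phi a); elim: N a => // N IH a hN Ja.
case: (pselect (exists2 m, (mdeg m < d)%N & a m <> 0)) => [[m1 hm1 am1]|hn]; last first.
  exists (fun=> 0) => m hm; rewrite big1 ?subr0 => [|j _]; last by rewrite mul0r.
  by apply: contrapT => h; apply: hn; exists m.
have [m am hle] := ex_initial am1.
have hm : (mdeg m < d)%N by apply: leq_ltn_trans (lemc_mdeg hle) hm1.
have [j [m' [gm' hmm']]] := hg _ _ Ja am.
have [x hx] := reduce_initial am gm' hmm'.
have [||b hb] := IH (x * g j + a).
- rewrite -ltnS; apply: leq_trans hN; rewrite ltnS; apply: proper_card.
  apply/properP; split.
    apply/subsetP => m2; rewrite !inE => /asboolP [m3 h3 hx3]; apply/asboolP.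
    exists m; last exact: am.1.
    by apply: le_trans h3; rewrite leNgt; apply/negP => /ltW /hx.
  exists (BMultinom hm); rewrite inE.
    by apply/asboolP; exists m => //; exact: am.1.
  by apply/asboolP => -[m3 /hx].
- exact: J_lin.
exists (fun i => b i - (if i == j then x else 0)) => m2 /hb <-; congr (fcoef _ m2).
under eq_bigr do rewrite mulrBl.
rewrite sumrB opprB [x * _ + a]addrC -addrA; congr (_ + _).
rewrite addrC [RHS]addrC; congr (_ + _).
rewrite (bigD1 j) //= eqxx big1 ?addr0 // => i /negbTE ->.
by rewrite mul0r.
Qed.

(** The span of a standard basis [g] is dense in [J] by [ideal_dense]. If [e] is
    orthogonal to this span, it pairs to 0 with elements of large order, so it is
    orthogonal to [J] too, and [span_biorthogonal] concludes. *)
Lemma ideal_fg : exists (s : nat) (g : 'I_s -> A), (forall j, J (g j)) /\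
  forall a, J a -> exists b : 'I_s -> A, a = \sum_j b j * g j.
Proof.
have [s [g [Jg hg]]] := ex_standard_basis; exists s, g; split=> // a Ja.
have [e he|b hb] :=
  @span_biorthogonal _ char0 _ unit _ (fun j _ => g j) (fun=> a); last first.
  by exists b; apply: hb tt.
have [d hd] := ex_msize_bound e; have [b hb] := ideal_dense Jg hg d Ja.
have := pairingBl (fun=> a) (fun=> \sum_j b j * g j) e; rewrite he subr0 => <-.
by apply: (pairing_truncate hd) => l m; apply: hb.
Qed.
End Ideal.

Section Submodule.
Variables (I : finType) (K : (I -> A) -> Prop).
Hypothesis K_lin : forall x c d, K c -> K d -> K (fun l => x * c l + d l).
Hypothesis K0 : K (fun=> 0).

Lemma submodule_sum (J : finType) (b : J -> A) (g : J -> I -> A) :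
  (forall j, K (g j)) -> K (fun l => \sum_j b j * g j l).
Proof.
move=> Kg; suff h s : K (fun l => \sum_(j <- s) b j * g j l) by apply: h.
elim: s => [|j s IH].
  by have -> : (fun l => \sum_(j <- [::]) b j * g j l) = (fun=> 0) by
    apply: funext => l; rewrite big_nil.
have -> : (fun l => \sum_(i <- j :: s) b i * g i l)
  = (fun l => b j * g j l + \sum_(i <- s) b i * g i l).
  by apply: funext => l; rewrite big_cons.
exact: K_lin.
Qed.

(** The usual reduction to ideals, by induction on the set of coordinates that
    may be nonzero: the [i]-th coordinates form an ideal, and subtracting
    multiples of lifts of its generators makes the [i]-th coordinate zero. *)
Lemma submodule_fg : exists (J : finType) (g : J -> I -> A), (forall j, K (g j)) /\
  forall c, K c -> exists b : J -> A, forall l, c l = \sum_j b j * g j l.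
Proof.
suff [J [g [Kg hg]]] : exists (J : finType) (g : J -> I -> A), (forall j, K (g j)) /\
    forall c, K c -> (forall l, l \notin enum I -> c l = 0) ->
      exists b : J -> A, forall l, c l = \sum_j b j * g j l.
  exists J, g; split=> // c Kc; apply: hg => // l.
  by rewrite mem_enum.
elim: (enum I) => [|i r [J2 [g2 [Kg2 hg2]]]].
  exists void, (fun=> fun=> 0); split=> [[]|c Kc hc]; exists (fun=> 0) => l.
  by rewrite big1 ?hc // => -[].
pose J x := exists c, [/\ K c, forall l, l \notin i :: r -> c l = 0 & c i = x].
have [|s [f [Jf hf]]] := @ideal_fg J.
  move=> x a b [c [Kc c0 <-]] [d [Kd d0 <-]]; exists (fun l => x * c l + d l).
  split=> [|l hl|//]; first exact: K_lin.
  by rewrite c0 // d0 // mulr0 addr0.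
have /choice [g1 hg1] := Jf.
exists ('I_s + J2)%type, (fun j => match j with inl j1 => g1 j1 | inr j2 => g2 j2 end).
split=> [[j|j]|c Kc c0]; [by case: (hg1 j)|exact: Kg2|].
have [|b1 hb1] := hf (c i); first by exists c.
pose c' l := c l - \sum_j b1 j * g1 j l.
have [||b2 hb2] := hg2 c'.
- have := K_lin (-1) (submodule_sum b1 (fun j => let: And3 h _ _ := hg1 j in h)) Kc.
  by congr K; apply: funext => l; rewrite mulN1r addrC.
- move=> l hl; rewrite /c'; have [->|hne] := eqVneq l i.
    rewrite hb1; apply/eqP; rewrite subr_eq0; apply/eqP; apply: eq_bigr => j _.
    by case: (hg1 j) => _ _ ->.
  have hl' : l \notin i :: r by rewrite inE negb_or hne.
  rewrite c0 // big1 ?subr0 // => j _; case: (hg1 j) => _ e _.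
  by rewrite e // mulr0.
exists (fun j => match j with inl j1 => b1 j1 | inr j2 => b2 j2 end) => l.
by rewrite big_sumType /= -hb2 addrC subrK.
Qed.
End Submodule.
End Noetherian.

(** * Surjectivity onto a power of [E] *)

Section InverseSystem.
Variables (k : fieldType) (char0 : [pchar k] =i pred0) (n : nat).
Local Notation D := (diffop k n).
Local Notation E := (inv_module n char0).

(** The operators [partial_i x_i] act diagonally on the monomials of [E]. *)
Lemma euler_coef i (e : E) c :
  ((dop_partial k i * dop_mul (fps_X k U_(i))) *: e : {mpoly k[n]})@_c
  = - (c i)%:R * (e : {mpoly k[n]})@_c.
Proof.
rewrite -scalerA inv_scale_partial inv_partialE inv_scale_mul.
have [->|ci] := eqVneq (c i) 0%N; first by rewrite oppr0 !mul0r.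
congr (_ * _); set e' : {mpoly k[n]} := e.
have hU : (mdeg (U_(i)%MM : 'X_{1..n}) < (msize e').+2)%N by rewrite mdeg1.
rewrite (@inv_mulE _ _ (msize e').+2) ?leqW //.
rewrite (bigD1 (BMultinom hU)) //= eqxx mul1r submK; last by rewrite lep1mP.
rewrite big1 ?addr0 // => m; rewrite -val_eqE /= => /negbTE ->.
by rewrite mul0r.
Qed.

(** [1 + j^-1 partial_i x_i] multiplies the monomial of index [c] by
    [1 - c_i / j]. The product of these operators over all [i] and
    [1 <= j <= d] fixes the monomial of index 0 and kills the monomials of index
    [c != 0] of degree less than [d]. *)
Lemma residue_projector d : exists P : D,
  forall e : E, (msize (e : {mpoly k[n]}) <= d)%N ->
  P *: e = dop_const n (residue e) *: ('X_[0] : E).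
Proof.
have [P hP] : exists P : D, forall (e : E) c, (P *: e : {mpoly k[n]})@_c
    = (\prod_(x <- [seq (i, j) | i <- enum 'I_n, j <- iota 1 d])
        (1 - (c x.1)%:R / x.2%:R))
      * (e : {mpoly k[n]})@_c.
  elim: [seq (i, j) | i <- enum 'I_n, j <- iota 1 d] => [|[i j] s [P hP]].
    by exists 1 => e c; rewrite scale1r big_nil mul1r.
  exists ((1 + dop_const n j%:R^-1 * (dop_partial k i * dop_mul (fps_X k U_(i))))
    * P) => e c.
  rewrite -scalerA scalerDl scale1r mcoeffD hP -scalerA dop_const_inv mcoeffZ.
  rewrite euler_coef hP.
  rewrite big_cons /= -mulrA [in RHS]mulrBl mul1r; congr (_ + _).
  by rewrite !mulNr mulrN mulrA [_^-1 * _]mulrC.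
exists P => e he; apply/mpolyP => c; rewrite hP dop_const_inv mcoeffZ mcoeffX.
have [<-|c0] := eqVneq 0%MM c.
  by rewrite mulr1 big1 ?mul1r // => x _; rewrite mnm0E mul0r subr0.
rewrite mulr0; case: (ltnP (mdeg c) d) => hc; last first.
  rewrite (_ : (e : {mpoly k[n]})@_c = 0) ?mulr0 //; apply: memN_msupp_eq0.
  by apply/negP => /msize_mdeg_lt; rewrite ltnNge (leq_trans he hc).
rewrite eq_sym -mdeg_eq0 mdegE sum_nat_eq0 negb_forall in c0.
case/existsP: c0 => i /= ci.
have hx : (i, c i) \in [seq (i, j) | i <- enum 'I_n, j <- iota 1 d].
  apply/allpairsP; exists (i, c i); split=> //=; first by rewrite mem_enum.
  rewrite mem_iota lt0n ci add1n ltnS; apply: leq_trans (ltnW hc).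
  by rewrite mdegE (bigD1 i) //= leq_addr.
rewrite (big_rem _ hx) /= divff ?subrr ?mul0r //.
by rewrite (pcharf0P _).1.
Qed.

Lemma inv_module_generated (e : E) : exists P : D, P *: ('X_[0] : E) = e.
Proof.
have X_gen (b : 'X_{1..n}) : exists P : D, P *: ('X_[0] : E) = 'X_[b].
  have [d] := ubnP (mdeg b); elim: d b => // d IH b hd.
  have [->|] := eqVneq b 0%MM; first by exists 1; rewrite scale1r.
  rewrite -mdeg_eq0 mdegE sum_nat_eq0 negb_forall => /existsP [i /= hi].
  have eb : b = (b - U_(i) + U_(i))%MM by rewrite submK // lep1mP.
  have [|P hP] := IH (b - U_(i))%MM.
    by move: hd; rewrite {1}eb mdegD mdeg1 addn1.
  exists (dop_const n (- (b i)%:R)^-1 * dop_partial k i * P).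
  rewrite -!scalerA hP inv_scale_partialX dop_const_inv -eb scalerA.
  rewrite mnmBE mnm1E eqxx subn1 prednK ?lt0n // mulVf ?scale1r //.
  by rewrite oppr_eq0 (pcharf0P _).1.
set e' : {mpoly k[n]} := e; have /choice [P hP] := X_gen.
exists (\sum_(b <- msupp e') dop_const n e'@_b * P b).
rewrite scaler_suml [RHS](mpolyE e'); apply: eq_bigr => b _.
by rewrite -scalerA hP dop_const_inv.
Qed.
End InverseSystem.

(** * Solutions of the relations of a module, and the theorem *)

Section Solutions.
Variables (k : fieldType) (char0 : [pchar k] =i pred0) (n : nat).
Local Notation A := (fps k n).
Local Notation D := (diffop k n).
Local Notation E := (inv_module n char0).
Variables (M : lmodType D) (I : finType) (u : I -> M) (Q : nat -> D).
Local Notation apply_row := (@apply_row k char0 n I).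

(** The relations of [u] whose entries are [A]-combinations of the first [j]
    operators of the sequence [Q]. *)
Definition relation_in (j : nat) (P : I -> D) : Prop :=
  (forall l, left_span Q j (P l)) /\ \sum_l P l *: u l = 0.

Definition solution_of (j : nat) (e : {ffun I -> {mpoly k[n]}}) : Prop :=
  forall P, relation_in j P -> apply_row P e = 0.

(** A row with entries spanned by [Q_0, ..., Q_(j-1)] is given by a vector of
    [A^(I * j)], and the vectors that give relations form a submodule. *)
Lemma relation_in_fg j : exists (J : finType) (G : J -> I -> D),
  (forall t, relation_in j (G t)) /\
  forall P, relation_in j P ->
    exists b : J -> A, P = (fun l => \sum_t dop_mul (b t) * G t l).
Proof.
pose row (c : I * 'I_j -> A) l := \sum_i dop_mul (c (l, i)) * Q i.
have row_lin x c d l : row (fun y => x * c y + d y) l = dop_mul x * row c l + row d l.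
  rewrite mulr_sumr -big_split; apply: eq_bigr => i _.
  by rewrite dop_mulD dop_mulM mulrDl mulrA.
have row0 l : row (fun=> 0) l = 0 by rewrite /row big1 // => i _; rewrite mul0r.
have row_span c l : left_span Q j (row c l).
  exists (fun i => if insub i is Some i' then c (l, i') else 0).
  by apply: eq_bigr => i _; rewrite valK.
have [||J [g [Kg hg]]] :=
  @submodule_fg k char0 n _ (fun c => \sum_l row c l *: u l = 0).
- move=> x c d hc hd; under eq_bigr do rewrite row_lin scalerDl -scalerA.
  by rewrite big_split /= -scaler_sumr hc hd scaler0 addr0.
- by rewrite big1 // => l _; rewrite row0 scale0r.
exists J, (fun t => row (g t)); split=> [t|P [/choice [a ha] hP]]; first by split.
have Prow : P = row (fun y => a y.1 y.2) by apply: funext => l; rewrite ha.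
have [|b hb] := hg (fun y => a y.1 y.2); first by rewrite -Prow.
exists b; rewrite Prow; apply: funext => l; rewrite /row.
under eq_bigr do rewrite hb dop_mul_sum mulr_suml.
rewrite exchange_big; apply: eq_bigr => t _ /=; rewrite mulr_sumr.
by apply: eq_bigr => i _; rewrite dop_mulM mulrA.
Qed.

Lemma relation_in_leq j j' P : (j <= j')%N -> relation_in j P -> relation_in j' P.
Proof. by move=> hj [h1 h2]; split=> // l; apply: left_span_leq (h1 l). Qed.

Lemma solution_of_leq j j' e : (j <= j')%N -> solution_of j' e -> solution_of j e.
Proof. by move=> hj h P hP; apply: h; apply: relation_in_leq hP. Qed.

Lemma solution_of_lin j c e e' :
  solution_of j e -> solution_of j e' -> solution_of j (c *: e + e').
Proof.
move=> h h' P hP; rewrite apply_row_linear h // h' // addr0.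
exact: (@scaler0 _ {mpoly k[n]} c).
Qed.

(** The solutions in question are those of a finite system, the generators of
    the relations. *)
Lemma boundary_of_vanishing j (a : I -> A) :
  (forall e, solution_of j e -> pairing a e = 0) ->
  boundary (\sum_l dop_mul (a l) *: u l).
Proof.
have [J [G [hG genG]]] := relation_in_fg j => ha.
apply: (@boundary_of_finite_system k char0 n I J G) => [t|e he]; first exact: (hG t).2.
apply: ha => P /genG [b ->].
transitivity (\sum_t dop_mul (b t) *: apply_row (G t) e).
  rewrite /apply_row; under eq_bigr do rewrite scaler_suml.
  rewrite exchange_big; apply: eq_bigr => t _ /=; rewrite scaler_sumr.
  by apply: eq_bigr => l _; rewrite scalerA.
by rewrite big1 // => t _; rewrite he scaler0.
Qed.

Hypothesis u_gen : forall v, exists P : I -> D, v = \sum_l P l *: u l.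
Hypothesis Q_span : forall P, exists j, left_span Q j P.

Lemma relation_in_ex P : \sum_l P l *: u l = 0 -> exists j, relation_in j P.
Proof.
move=> hP; have /choice [j hj] l := Q_span (P l).
exists (\max_l j l); split=> // l; apply: left_span_leq (hj l).
exact: leq_bigmax.
Qed.

(** If [\sum_l a_l u_l = \sum_i partial_i w_i] with [w_i = \sum_l P_il u_l], then
    [a_l - \sum_i partial_i P_il] is a relation, and on its solutions [e] the
    residue of [\sum_l a_l e_l] is that of a sum of derivatives. *)
Lemma vanishing_of_boundary (a : I -> A) : boundary (\sum_l dop_mul (a l) *: u l) ->
  exists j, forall e, solution_of j e -> pairing a e = 0.
Proof.
move=> [w hw]; have /choice [P hP] i := u_gen (w i).
pose R l := dop_mul (a l) + \sum_i dop_partial k i * - P i l.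
have [|j hj] := @relation_in_ex R.
  rewrite /R; under eq_bigr do rewrite scalerDl scaler_suml.
  rewrite big_split /= hw exchange_big /= -big_split big1 //= => i _.
  rewrite hP scaler_sumr -big_split big1 //= => l _.
  by rewrite mulrN scaleNr scalerA addrN.
exists j => e /(_ _ hj) he.
have := @residue_apply_row k char0 n I R a (fun l i => - P i l) e (fun=> erefl).
by rewrite he residue0.
Qed.

(** For each [j] there is a family dual to [a] among the solutions of the
    relations of level [j] ([dual]). From some level [j0] on, such a family is
    unique ([W0]), so the one of level [j0] solves the relations of all
    levels. *)
Lemma dual_solutions (m : nat) (a : 'I_m -> I -> A) :
  (forall c : 'I_m -> k,
     boundary (\sum_l dop_mul (\sum_i fps_const n (c i) * a i l) *: u l) ->
     forall i, c i = 0) ->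
  (forall b : I -> A, exists c : 'I_m -> k,
     boundary (\sum_l dop_mul (b l - \sum_i fps_const n (c i) * a i l) *: u l)) ->
  exists h : 'I_m -> {ffun I -> {mpoly k[n]}},
    (forall t j, solution_of j (h t)) /\
    forall i t, pairing (a i) (h t) = (i == t)%:R.
Proof.
move=> a_free a_span.
have pairing_comb (c : 'I_m -> k) e :
    pairing (fun l => \sum_i fps_const n (c i) * a i l) e
    = \sum_i c i * pairing (a i) e.
  rewrite /pairing; under eq_bigr do rewrite inv_mul_suml raddf_sum.
  rewrite exchange_big; apply: eq_bigr => i _; rewrite mulr_sumr.
  by apply: eq_bigr => l _ /=; rewrite inv_mulA inv_mul_const mcoeffZ.
have sol0 j : solution_of j 0.
  by move=> P _; apply: big1 => l _; rewrite ffunE; apply: (@scaler0 _ E).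
have solZ j c e : solution_of j e -> solution_of j (c *: e).
  by move=> h; rewrite -[c *: e]addr0; apply: solution_of_lin.
have solB j e e' : solution_of j e -> solution_of j e' -> solution_of j (e - e').
  by move=> h h'; rewrite addrC -scaleN1r; apply: solution_of_lin.
have pairingZ b c e : pairing b (c *: e) = c * pairing b e.
  have := pairing_scalar b c e 0; rewrite addr0 => ->.
  by have := pairingB b 0 0; rewrite !subrr => ->; rewrite addr0.
pose W j e := solution_of j e /\ forall i, pairing (a i) e = 0.
have [j0 W0] : exists j, forall e, W j e -> e = 0.
  apply: contrapT => hn.
  have [||||b hb] := @pairing_nonzero_on_chain k n I W.
  - move=> j v w [h1 h2] [h1' h2']; split; first exact: solB.
    by move=> i; rewrite pairingB h2 h2' subrr.
  - move=> j c v [h1 h2]; split; first exact: solZ.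
    by move=> i; rewrite pairingZ h2 mulr0.
  - by move=> j j' e hj [h1 h2]; split=> //; apply: solution_of_leq h1.
  - move=> j; apply: contrapT => hj; apply: hn; exists j => e We.
    by apply: contrapT => e0; apply: hj; exists e.
  have [c /vanishing_of_boundary [j hj]] := a_span b.
  have [e [sol_e ae] be] := hb j; apply: be.
  have := hj e sol_e; rewrite pairingBl pairing_comb big1 ?subr0 // => i _.
  by rewrite ae mulr0.
have dual j : exists h : 'I_m -> {ffun I -> {mpoly k[n]}},
    forall t, solution_of j (h t) /\ forall i, pairing (a i) (h t) = (i == t)%:R.
  pose S (v : 'rV[k]_m) :=
    exists2 e, solution_of j e & forall i, v 0 i = pairing (a i) e.
  have S_full : forall v, S v.
    apply: separated_subspace_full.
    - by exists 0 => // i; rewrite mxE -[0 in RHS](subrr 0) pairingB subrr.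
    - move=> c v w [e1 h1 a1] [e2 h2 a2].
      exists (c *: e1 + e2); first exact: solution_of_lin.
      by move=> i; rewrite !mxE a1 a2 pairing_scalar.
    - move=> c hc; apply/colP => i; rewrite mxE.
      apply: (a_free (fun i => c i 0)).
      apply: (@boundary_of_vanishing j
        (fun l => \sum_i0 fps_const n (c i0 0) * a i0 l)).
      move=> e he.
      have Se : S (\row_i pairing (a i) e) by exists e => // i'; rewrite mxE.
      have /matrixP/(_ 0 0) := hc _ Se.
      rewrite !mxE pairing_comb => hs.
      rewrite -[RHS]hs; apply: eq_bigr => i' _.
      by rewrite mxE mulrC.
  have /choice [h hh] t : exists e, solution_of j e /\
      forall i, pairing (a i) e = (i == t)%:R.
    have [e h1 h2] := S_full (delta_mx 0 t); exists e; split=> // i.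
    by rewrite -h2 mxE eqxx.
  by exists h.
have [h hh] := dual j0; exists h; split=> [t j|i t]; last exact: (hh t).2.
case: (leqP j j0) => hj; first exact: solution_of_leq (hh t).1.
have [h' hh'] := dual j; have -> // : h t = h' t; last exact: (hh' t).1.
apply/eqP; rewrite -subr_eq0; apply/eqP; apply: W0; split.
  by apply: solB (hh t).1 _; apply: solution_of_leq (ltnW hj) (hh' t).1.
by move=> i; rewrite pairingB (hh t).2 (hh' t).2 subrr.
Qed.

(** Sending [u_l] to [(h_1 l, ..., h_m l)] respects all relations of [u], since
    each of them occurs at some level [j]. *)
Lemma linear_of_solutions (m : nat) (h : 'I_m -> {ffun I -> {mpoly k[n]}}) :
  (forall t j, solution_of j (h t)) ->
  exists f : {linear M -> {ffun 'I_m -> E}},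
    forall P t, f (\sum_l P l *: u l) t = apply_row P (h t).
Proof.
move=> h_sol.
have actB P P' e : apply_row (fun l => P l - P' l) e = apply_row P e - apply_row P' e.
  by rewrite -sumrB; apply: eq_bigr => l _; rewrite scalerBl.
have /choice [P hP] := u_gen.
have well_def R v t : v = \sum_l R l *: u l -> apply_row (P v) (h t) = apply_row R (h t).
  move=> hv; apply/eqP; rewrite -subr_eq0 -actB; apply/eqP.
  have [|j hj] := @relation_in_ex (fun l => P v l - R l); last exact: h_sol hj.
  by under eq_bigr do rewrite scalerBl; rewrite sumrB -hP -hv subrr.
pose f v : {ffun 'I_m -> E} := [ffun t => apply_row (P v) (h t)].
have f_lin : linear f.
  move=> c v w; apply/ffunP => t; rewrite !ffunE.
  rewrite (@well_def (fun l => c * P v l + P w l)).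
    rewrite /apply_row scaler_sumr -big_split; apply: eq_bigr => l _.
    by rewrite scalerDl scalerA.
  rewrite {1}[v]hP {1}[w]hP scaler_sumr -big_split; apply: eq_bigr => l _ /=.
  by rewrite scalerDl scalerA.
pose F : {linear M -> {ffun 'I_m -> E}} :=
  HB.pack f (GRing.isLinear.Build _ _ _ _ f f_lin).
by exists F => R t; rewrite /F /= ffunE; apply: well_def.
Qed.
End Solutions.

(** The projector of [residue_projector] sends [f (e i)] to the element of [E^m]
    with entry [x_1^-1 ... x_n^-1] at place [i] and 0 elsewhere, and these
    elements generate [E^m]. *)
Lemma linear_onto (k : fieldType) (char0 : [pchar k] =i pred0) (n : nat)
    (M : lmodType (diffop k n)) (m : nat)
    (f : {linear M -> {ffun 'I_m -> inv_module n char0}}) (e : 'I_m -> M) :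
  (forall i t, residue (f (e i) t) = (i == t)%:R) -> forall y, exists x, f x = y.
Proof.
move=> he y.
pose size_at i t := msize (f (e i) t : {mpoly k[n]}).
have [P hP] := residue_projector char0 n (\max_i \max_t size_at i t).
have PE i t : P *: f (e i) t = dop_const n (i == t)%:R *: ('X_[0] : inv_module n char0).
  rewrite hP ?he //; apply: leq_trans (leq_bigmax (F := fun i => \max_t size_at i t) i).
  exact: (leq_bigmax (F := size_at i)).
have /choice [Q hQ] t := inv_module_generated (y t).
exists (\sum_i (Q i * P) *: e i); apply/ffunP => t.
rewrite linear_sum sum_ffunE (bigD1 t) //= big1 ?addr0 => [|i /negbTE hi].
  by rewrite linearZ ffunE -scalerA PE eqxx [dop_const _ _]dop_mul1 scale1r hQ.
rewrite linearZ ffunE -scalerA PE hi.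
have -> : dop_const n (0 : k) = 0 by apply: dop_mul0.
by rewrite scale0r scaler0.
Qed.

Theorem theorem5p1 (k : fieldType) (char0 : [pchar k] =i pred0) (n : nat)
    (M : lmodType (diffop k n)) (m : nat) :
  holonomic M ->
  dR_dim M n m ->
  exists f : {linear M -> {ffun 'I_m -> inv_module n char0}},
    forall y, exists x, f x = y.
Proof.
move=> hM /dR_dim_top [e [_ e_span e_free]].
have [r [u u_gen]] : exists (r : nat) (u : 'I_r -> M), dmod_generates u.
  case: hM => [M0|[r [u [hu _]]]]; last by exists r, u.
  by exists 0%N, (fun=> 0) => v; exists (fun=> 0); rewrite big_ord0.
have [Q Q_span] := @diffop_countably_spanned k n.
have /choice [R eR] i := u_gen (e i).
have /choice [a /choice [S aS]] : forall i, exists (a : 'I_r -> fps k n), exists S,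
    forall l, R i l = dop_mul (a l) + \sum_j dop_partial k j * S l j.
  move=> i; have /choice [a /choice [S aS]] l := diffop_mod_partials (R i l).
  by exists a, S.
have e_comb (c : 'I_m -> k) : boundary (\sum_i dop_const n (c i) *: e i
    - \sum_l dop_mul (\sum_i fps_const n (c i) * a i l) *: u l).
  rewrite [X in _ - X](_ : _
    = \sum_i dop_const n (c i) *: \sum_l dop_mul (a i l) *: u l).
    rewrite -sumrB; apply: boundary_sum => i; rewrite -scalerBr; apply: boundaryZ.
    rewrite eR -sumrB; apply: boundary_sum => l.
    by rewrite aS scalerDl addrC addKr; apply: boundary_scale.
  under eq_bigr do rewrite dop_mul_sum scaler_suml.
  rewrite exchange_big; apply: eq_bigr => i _ /=; rewrite scaler_sumr.
  by apply: eq_bigr => l _; rewrite scalerA -dop_mulM.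
have [||h [h_sol h_dual]] := @dual_solutions k char0 n M _ u Q u_gen Q_span m a.
- move=> c hc; apply: e_free; have := boundaryD (e_comb c) hc.
  by rewrite subrK.
- move=> b; have [c hc] := e_span (\sum_l dop_mul (b l) *: u l) I; exists c.
  have := boundaryD hc (e_comb c); rewrite addrA subrK -sumrB.
  by under eq_bigr do rewrite -scalerBl -dop_mulN -dop_mulD.
have [f hf] := linear_of_solutions u_gen Q_span h_sol.
exists f; apply: (@linear_onto _ _ _ _ _ f e) => i t.
by rewrite eR hf (residue_apply_row (Q := S i) _ (c := a i)) ?h_dual //; apply: aS.
Qed.
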